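(* Let $k\ge 0$, $1\le p<+\infty$ and $f\in L^p(\mathbb{R},|x|^{2k}dx)$. For every $t>0$, the Poisson integral $F_k(f)(t,x)=\sum_{n=0}^{+\infty}e^{-t\sqrt{2n+2k+1}}a_n^k(f)h_n^k(x)$ satisfies $F_k(f)(t,\cdot)\in L^p(\mathbb{R},|x|^{2k}dx)$ and $$\|F_k(f)(t,\cdot)\|_{k,p}\le 2^{k+\frac12}e^{-t\sqrt{2k+1}}\|f\|_{k,p}.$$
   Context: Dunkl--Hermite functions: for $n\ge 0$, $h_n^k(x)=e^{-x^2/2}H_n^k(x)$, where $$H_{2n}^k(x)=(-1)^n\sqrt{\tfrac{n!}{\Gamma(n+k+\frac12)}}\,L_n^{k-\frac12}(x^2),\qquad H_{2n+1}^k(x)=(-1)^n\sqrt{\tfrac{n!}{\Gamma(n+k+\frac32)}}\,x\,L_n^{k+\frac12}(x^2),$$ and $L_n^\alpha(x)=\frac{1}{n!}x^{-\alpha}e^x\frac{d^n}{dx^n}(x^{n+\alpha}e^{-x})$ are the Laguerre polynomials. $L^p(\mathbb{R},|x|^{2k}dx)$ is the space of measurable $f$ on $\mathbb{R}$ with $\|f\|_{k,p}=\left(\int_{\mathbb{R}}|f(x)|^p|x|^{2k}dx\right)^{1/p}<+\infty$. The coefficients are $a_n^k(f)=\int_{\mathbb{R}}f(t)h_n^k(t)|t|^{2k}dt$. *)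

(* Defs.v *)
From HB Require Import structures.
From mathcomp Require Import all_boot all_order all_algebra.
From mathcomp Require Import all_classical all_reals all_analysis.
From mathcomp Require Import ring.
Set Implicit Arguments.
Unset Strict Implicit.
Unset Printing Implicit Defensive.
Import Order.TTheory GRing.Theory Num.Theory.
Import numFieldNormedType.Exports.
Local Open Scope classical_set_scope.
Local Open Scope ring_scope.

(* Only used for a > 0, where the integral converges. *)
Definition Gamma (R : realType) (a : R) : R :=
  \int[lebesgue_measure]_(x in `]0, +oo[) (x `^ (a - 1) * expR (- x)).

Definition laguerre_rodrigues (R : realType) (a : R) (n : nat) (x : R) : R :=
  (n`!%:R)^-1 * x `^ (- a) * expR x
  * derive1n n (fun y : R => y `^ (n%:R + a) * expR (- y)) x.

(* Rodrigues' formula only makes sense for x > 0; the Laguerre polynomial is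
   the polynomial that it defines there, see laguerreP and laguerre_unique. *)
Definition laguerre (R : realType) (a : R) (n : nat) : {poly R} :=
  xget 0 [set q : {poly R} |
    forall x : R, 0 < x -> q.[x] = laguerre_rodrigues a n x].

Lemma is_derive_powR_expR_poly (R : realType) (b : R) (q : {poly R}) (x : R) :
  0 < x ->
  is_derive x 1 (fun y : R => y `^ b * expR (- y) * q.[y])
    (x `^ (b - 1) * expR (- x) * (b *: q + 'X * (q^`() - q)).[x]).
Proof.
move=> x0.
have h1 := is_derive1_powR b x0.
have h2 : is_derive x 1 (fun y : R => expR (- y)) (expR (- x) * (- 1)).
  exact: is_derive1_comp.
have h3 : is_derive x 1 (fun y : R => q.[y]) (q^`().[x]).
  exact: is_derive_poly.
have h := is_deriveM (is_deriveM h1 h2) h3.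
apply: is_derive_eq h _.
rewrite !hornerE /GRing.scale /= mulrfctE.
have -> : x `^ b = x `^ (b - 1) * x.
  rewrite powRB; last by rewrite (@gt_eqF _ _ x) ?implybT.
  by rewrite powRr1 ?ltW// divfK ?gt_eqF.
by ring.
Qed.

Lemma derive1n_powR_expR (R : realType) (b : R) (j : nat) :
  exists q : {poly R}, forall x : R, 0 < x ->
    derive1n j (fun y : R => y `^ b * expR (- y)) x =
    x `^ (b - j%:R) * expR (- x) * q.[x].
Proof.
elim: j => [|j [q IH]].
  by exists 1 => x x0; rewrite derive1n0 subr0 hornerE mulr1.
exists ((b - j%:R) *: q + 'X * (q^`() - q)) => x x0.
rewrite derive1nS derive1E.
have := is_derive_powR_expR_poly (b - j%:R) q x0.
rewrite -natr1 opprD addrA => -[_ <-].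
apply: near_eq_derive; near=> y; apply: IH.
by near: y; exact: lt_nbhsr.
Unshelve. all: by end_near. Qed.

Lemma laguerreP (R : realType) (a : R) (n : nat) (x : R) :
  0 < x -> (laguerre a n).[x] = laguerre_rodrigues a n x.
Proof.
move: x; rewrite /laguerre; set P := [set _ | _].
suff : exists q, P q by move=> [q Pq]; exact: (xgetPex 0 (ex_intro P q Pq)).
have [q hq] := derive1n_powR_expR (n%:R + a) n.
exists ((n`!%:R)^-1 *: q) => x x0.
rewrite /laguerre_rodrigues hq// hornerZ addrAC subrr add0r.
rewrite powRN expRN.
by field; rewrite !gt_eqF ?expR_gt0 ?powR_gt0 ?ltr0n ?fact_gt0.
Qed.

Lemma laguerre_unique (R : realType) (a : R) (n : nat) (q : {poly R}) :
  (forall x : R, 0 < x -> q.[x] = laguerre_rodrigues a n x) ->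
  q = laguerre a n.
Proof.
move=> hq; apply/eqP; rewrite -subr_eq0; apply/eqP.
set r := _ - _; pose s := [seq i.+1%:R | i <- iota 0 (size r)] : seq R.
apply: (@roots_geq_poly_eq0 _ _ s); last by rewrite size_map size_iota.
  apply/allP => _ /mapP[i _ ->].
  by rewrite /root /r hornerD hornerN hq ?laguerreP ?ltr0n// subrr.
by rewrite map_inj_uniq ?iota_uniq// => i j /eqP; rewrite eqr_nat => /eqP[].
Qed.

Definition dunkl_hermite_poly (R : realType) (k : R) (m : nat) (x : R) : R :=
  let n := m./2 in
  if odd m then
    (-1) ^+ n * Num.sqrt (n`!%:R / Gamma (n%:R + k + 3 / 2)) * x
    * (laguerre (k + 1 / 2) n).[x ^+ 2]
  else
    (-1) ^+ n * Num.sqrt (n`!%:R / Gamma (n%:R + k + 1 / 2))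
    * (laguerre (k - 1 / 2) n).[x ^+ 2].

Definition dunkl_hermite (R : realType) (k : R) (n : nat) (x : R) : R :=
  expR (- (x ^+ 2 / 2)) * dunkl_hermite_poly k n x.

Definition dunkl_norm (R : realType) (k p : R) (f : R -> R) : \bar R :=
  poweR (\int[lebesgue_measure]_x (`|f x| `^ p * `|x| `^ (2 * k))%:E)%E p^-1.

Definition dunkl_Lp (R : realType) (k p : R) : set (R -> R) :=
  [set f | measurable_fun [set: R] f /\ (dunkl_norm k p f < +oo)%E].

Definition dunkl_coef_integrand (R : realType) (k : R) (f : R -> R) (n : nat)
  (x : R) : R := f x * dunkl_hermite k n x * `|x| `^ (2 * k).

Definition dunkl_coef (R : realType) (k : R) (f : R -> R) (n : nat) : R :=
  \int[lebesgue_measure]_x dunkl_coef_integrand k f n x.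

Definition poisson_term (R : realType) (k : R) (f : R -> R) (t x : R)
    (n : nat) : R :=
  expR (- (t * Num.sqrt (2 * n%:R + 2 * k + 1))) * dunkl_coef k f n
  * dunkl_hermite k n x.

Definition poisson (R : realType) (k : R) (f : R -> R) (t x : R) : R :=
  limn (series (poisson_term k f t x)).

(* Main.v *)
Require Import Defs.
From mathcomp Require Import all_boot all_order all_algebra.
From mathcomp Require Import all_classical all_reals all_analysis.
From mathcomp Require Import measurable_realfun ring lra.
Import Order.TTheory GRing.Theory Num.Theory.
Import numFieldNormedType.Exports.
Set Implicit Arguments.
Unset Strict Implicit.
Unset Printing Implicit Defensive.
Local Open Scope classical_set_scope.
Local Open Scope ring_scope.

(** Write w(y) = |y|^(2k), l_n = 2n + 2k + 1 and h_n for the Dunkl-Hermite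
functions. Inserting the coefficient integrals into the series shows that the
Poisson integral is an integral operator, F(x) = int P(x,y) f(y) w(y) dy, with
the symmetric kernel P(x,y) = sum_n e^(-t sqrt l_n) h_n(x) h_n(y). If P >= 0 and
int P(x,y) w(y) dy <= C for every x, then P is bounded by C on L^p(w) for every
p >= 1: Jensen's inequality on each row of the kernel, then Tonelli and the same
mass bound on the columns ([jensen_powR], [schur_powR]). So everything is in the
positivity of P and in the mass bound with C = 2^(k+1/2) e^(-t sqrt(2k+1))
([poisson_kernel_ge0], [integral_poisson_kernel_le]).

Both come from the heat kernel T_s(x,y) = sum_n e^(-s l_n) h_n(x) h_n(y) by
subordination: e^(-t sqrt l) is an average of the e^(-s l), since
e^(-t sqrt l) = 2/sqrt pi int_0^oo e^(-u^2) e^(-s l) du with s = t^2/(4u^2)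
([integral_subordinator]). Hence P is an average of heat kernels, and it suffices
that T_s >= 0 and int T_s(x,y) w(y) dy <= 2^(k+1/2) e^(-s(2k+1)): the average of
the right-hand side over s is exactly C.

With r = e^(-2s), T_s is e^(-s(2k+1)) times sum_n r^n h_n(x) h_n(y), for which
Mehler's formula gives a Gaussian in (x,y) times a generalized exponential of xy
([cvg_mehler]). That exponential is a power series whose coefficients satisfy the
first-order recurrence that expresses that it is an eigenfunction of the Dunkl
operator, and it is nonnegative on the whole line ([dunkl_kernel_ge0]). For the
mass, the part of the kernel that is odd in y integrates to 0, and the even part
integrates term by term through Gaussian moments, with value at most 2^(k+1/2)
([integral_mehler_le]).

Mehler's formula splits into its even and odd terms, and each half is the
Hille-Hardy formula for Laguerre polynomials ([hille_hardy]). The latter follows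
from the generating function of the Laguerre polynomials together with a product
formula of Bailey which expands L_n(x) L_n(y) into Laguerre polynomials in x + y
([lag_mul]); comparing coefficients there is the Pfaff-Saalschuetz summation.

What remains is to exchange series and integrals. Both e^(-t sqrt l_n) and r^n
decrease faster than any power of n, so it is enough that h_n grows polynomially
in n, both uniformly and in L^1(w) ([dunkl_hermite_growth]). This can be read off
Mehler's formula on the diagonal x = y, where all the terms are nonnegative: each
of them is at most the sum, at the value r = (n+1)/(n+2) for the index n. *)

(** * Series, and the exchange of series with integrals *)

Lemma nneseries_EFin_cvg (R : realType) (u : R^nat) (l : R) :
  (forall n, 0 <= u n) ->
  series u @ \oo --> l <-> (\sum_(n <oo) (u n)%:E = l%:E)%E.
Proof.
move=> u0; split => [ul|].
  apply/cvg_lim => //; under eq_fun do rewrite sumEFin.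
  exact/cvg_EFin/ul/nearW.
move=> ul; have cu : cvgn (series u) by apply: nnseries_is_cvg => //; rewrite ul ltry.
have : (\sum_(n <oo) (u n)%:E = (limn (series u))%:E)%E.
  rewrite -EFin_lim//; congr (limn _); apply/funext => n.
  by rewrite /= sumEFin.
by rewrite ul => -[->].
Qed.

Lemma series_le_lim (R : realType) (u : R^nat) (l : R) (n : nat) :
  (forall n, 0 <= u n) -> series u @ \oo --> l -> u n <= l.
Proof.
move=> u0 ul; rewrite -(cvg_lim _ ul)//.
apply: le_trans (nondecreasing_cvgn_le _ _ n.+1).
- by rewrite /series /= big_nat_recr//= lerDr sumr_ge0.
- exact: nondecreasing_series.
- by apply/cvg_ex; exists l.
Qed.

Lemma cvg_seriesD (R : realType) (u v : R^nat) (a b : R) :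
  series u @ \oo --> a -> series v @ \oo --> b ->
  series (fun n => u n + v n) @ \oo --> a + b.
Proof.
move=> ua vb; rewrite (_ : series _ = series u + series v); first exact: cvgD.
by rewrite -seriesD.
Qed.

Lemma cvg_seriesZ (R : realType) (u : R^nat) (a c : R) :
  series u @ \oo --> a -> series (fun n => c * u n) @ \oo --> c * a.
Proof.
move=> ua; rewrite (_ : series _ = (fun n => c * series u n)); first exact: cvgMl_tmp.
by apply/funext => n; rewrite /series /= mulr_sumr.
Qed.

(** Tonelli for series: summing a nonnegative double sequence along the
    antidiagonals gives the same total as summing it row by row. *)
Lemma ge0_cvg_triangular (R : realType) (c : nat -> nat -> R) (s : R^nat) (S : R) :
  (forall m j, 0 <= c m j) ->
  (forall m, series (c m) @ \oo --> s m) -> series s @ \oo --> S ->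
  series (fun n => \sum_(m < n.+1) c m (n - m)%N) @ \oo --> S.
Proof.
move=> c0 cs sS.
have s0 m : 0 <= s m by exact: le_trans (series_le_lim 0 (c0 m) (cs m)).
apply/nneseries_EFin_cvg => [n|]; first exact: sumr_ge0.
move/nneseries_EFin_cvg : sS => /(_ s0) <-.
pose a m n := (if (m <= n)%N then c m (n - m)%N else 0)%:E.
have a0 m n : (0 <= a m n)%E by rewrite lee_fin; case: ifP.
transitivity (\sum_(n <oo) \sum_(m <oo) a m n)%E.
  apply: eq_eseriesr => n _; rewrite (nneseries_split _ n.+1)//.
  rewrite eseries0 ?adde0; last first.
    by move=> m; rewrite add0n => nm _; rewrite /a leqNgt nm.
  rewrite add0n big_mkord -sumEFin; apply: eq_bigr => m _.
  by rewrite /a -ltnS ltn_ord.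
rewrite nneseries_interchange//; apply: eq_eseriesr => m _.
rewrite (nneseries_split _ m)// add0n big_nat_cond big1 ?add0e; last first.
  by move=> n; rewrite /a => /andP[/andP[_ nm] _]; rewrite leqNgt nm.
move/nneseries_EFin_cvg : (cs m) => /(_ (c0 m)) <-.
rewrite -nneseries_addn//; apply: eq_eseriesr => j _.
by rewrite /a leq_addl addnK.
Qed.

(** Absolutely convergent double series may be summed along the
    antidiagonals. A majorant [d] is used instead of |c| because in the
    applications the majorant is the same double series at other arguments, so
    that its row sums are known in closed form. The signed case reduces to the
    nonnegative one for c + d and d. *)
Lemma cvg_triangular (R : realType) (c d : nat -> nat -> R) (s b : R^nat) (S : R) :
  (forall m j, `|c m j| <= d m j) ->
  (forall m, series (d m) @ \oo --> b m) -> cvgn (series b) ->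
  (forall m, series (c m) @ \oo --> s m) -> series s @ \oo --> S ->
  series (fun n => \sum_(m < n.+1) c m (n - m)%N) @ \oo --> S.
Proof.
move=> cd db /cvg_ex[/= B bB] cs sS.
have d0 m j : 0 <= d m j by exact: le_trans (cd m j).
have h1 := ge0_cvg_triangular d0 db bB.
have h2 : series (fun n => \sum_(m < n.+1) (c m (n - m)%N + d m (n - m)%N)) @ \oo
    --> S + B.
  apply: (@ge0_cvg_triangular _ (fun m j => c m j + d m j) (fun m => s m + b m)).
  - by move=> m j; rewrite -lerBlDr sub0r; have := cd m j; rewrite ler_norml => /andP[].
  - by move=> m; exact: cvg_seriesD.
  - exact: cvg_seriesD.
have := cvg_seriesD h2 (cvg_seriesZ (c := -1) h1).
rewrite mulN1r addrK; apply: cvg_trans; apply: near_eq_cvg; apply: nearW => N.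
by apply: eq_bigr => n _; rewrite big_split/= mulN1r addrK.
Qed.

(** The partial sums of [u] are the partial sums of its even and of its odd
    terms, at uphalf n and half n. *)
Lemma cvg_series_interleave (R : realType) (u : R^nat) (a b : R) :
  series (fun n => u n.*2) @ \oo --> a ->
  series (fun n => u n.*2.+1) @ \oo --> b ->
  series u @ \oo --> a + b.
Proof.
move=> ua ub.
have -> : series u = (fun n => series (fun n => u n.*2) (uphalf n)
                      + series (fun n => u n.*2.+1) n./2).
  apply/funext; elim => [|n IH]; first by rewrite /series /= !big_nil addr0.
  rewrite seriesSr IH uphalfE /= -[in u n](odd_double_half n) uphalf_half.
  case: (odd n) => /=.
    by rewrite !add1n -addrA; congr (_ + _); rewrite [in RHS]seriesSr.
  by rewrite !add0n [in RHS]seriesSr addrAC.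
have h2 : (fun n : nat => n./2) @ \oo --> \oo.
  move=> A [N _ NA]; exists N.*2 => //= n /= Nn; apply: NA => /=.
  by rewrite -(doubleK N) half_leq.
have h1 : (fun n : nat => uphalf n) @ \oo --> \oo.
  move=> A [N _ NA]; exists N.*2 => //= n /= Nn; apply: NA => /=.
  by rewrite -(doubleK N) (leq_trans (half_leq Nn))// uphalf_half leq_addl.
by apply: cvgD; [exact: (cvg_comp _ _ h1 ua)|exact: (cvg_comp _ _ h2 ub)].
Qed.

(** Dominated convergence, with the dominating function sum_n |f_n|: it is
    integrable because its integral is at most the convergent sum of the bounds
    [b n]. *)
Lemma cvg_series_integral d (T : measurableType d) (R : realType)
    (mu : {measure set T -> \bar R}) (D : set T) (f : nat -> T -> R)
    (F : T -> R) (b : R^nat) :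
  measurable D -> (forall n, measurable_fun D (f n)) ->
  (forall n, (\int[mu]_(x in D) `|f n x|%:E <= (b n)%:E)%E) -> cvgn (series b) ->
  (forall x, D x -> series (f ^~ x) @ \oo --> F x) ->
  mu.-integrable D (EFin \o F) /\
  series (fun n => \int[mu]_(x in D) f n x) @ \oo --> \int[mu]_(x in D) F x.
Proof.
move=> mD mf fb cb fF.
have b0 n : 0 <= b n.
  by rewrite -lee_fin (le_trans _ (fb n))//; apply: integral_ge0 => x _; rewrite lee_fin.
have mnf n : measurable_fun D (EFin \o (fun x => `|f n x|)).
  by apply/measurable_EFinP; exact: measurableT_comp.
have fi n : mu.-integrable D (EFin \o f n).
  apply/integrableP; split; first exact/measurable_EFinP.
  exact: le_lt_trans (fb n) (ltry _).
pose g x := (\sum_(n <oo) `|f n x|%:E)%E.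
have mg : measurable_fun D (g : T -> \bar R).
  apply: (@ge0_emeasurable_sum _ _ _ D (fun n x => `|f n x|%:E) xpredT) => //.
  by move=> n _; exact: mnf.
have ig : mu.-integrable D g.
  apply/integrableP; split=> //.
  rewrite (eq_integral g) => [|x _]; last by rewrite gee0_abs//; exact: nneseries_ge0.
  rewrite integral_nneseries//.
  apply: (@le_lt_trans _ _ (\sum_(n <oo) (b n)%:E)%E).
    by apply: lee_nneseries => [n _ _|n _]; [exact: integral_ge0|exact: fb].
  have /cvg_ex[/= B bB] := cb.
  by move/nneseries_EFin_cvg : bB => -> //; rewrite ltry.
have mF : measurable_fun D F.
  apply: (measurable_fun_cvg (h := fun n x => series (f ^~ x) n)) => //.
  by move=> n; exact: measurable_sum.
have absF x : D x -> forall N, (`|(series (f ^~ x) N)%:E| <= g x)%E.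
  move=> Dx N; rewrite abse_EFin; apply: (@le_trans _ _ (\sum_(0 <= n < N) `|f n x|%:E)%E).
    by rewrite sumEFin lee_fin ler_norm_sum.
  by apply: nneseries_lim_ge => n _; rewrite lee_fin.
have [iF _ cF] : [/\ mu.-integrable D (EFin \o F),
    [sequence \int[mu]_(x in D) `|(series (f ^~ x) N)%:E - (F x)%:E|]_N @ \oo --> 0 &
    [sequence \int[mu]_(x in D) (series (f ^~ x) N)%:E]_N @ \oo
      --> \int[mu]_(x in D) (F x)%:E]%E.
  apply: (@dominated_convergence _ _ _ mu D mD
    (fun N x => (series (f ^~ x) N)%:E) (EFin \o F) g) => //.
  - by move=> N; apply/measurable_EFinP; exact: measurable_sum.
  - exact/measurable_EFinP.
  - by apply: aeW => x Dx; apply: cvg_EFin; [exact: nearW|exact: fF].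
  - by apply: aeW => x N Dx; exact: absF.
split => //.
have -> : series (fun n => \int[mu]_(x in D) f n x) =
    fine \o (fun N => \int[mu]_(x in D) (series (f ^~ x) N)%:E)%E.
  apply/funext => N; rewrite /series /=.
  under [in RHS]eq_integral do rewrite -sumEFin.
  rewrite integral_sum//= -sum_fine// => n _.
  exact: (integrable_fin_num mD (fi n)).
by apply: fine_cvg; rewrite fineK//; exact: (integrable_fin_num mD iF).
Qed.

(** * Integrals over the half-line *)

Lemma itv_pos_nondecreasing (R : realType) (F : R -> R) :
  (forall x y : R, 0 < x -> x <= y -> F x <= F y) ->
  nondecreasing_seq (fun n => `[F (n.+1%:R)^-1, F n.+1%:R]%classic).
Proof.
move=> Fnd n m nm; rewrite subsetEset => x /=.
rewrite !in_itv/= => /andP[nx xn]; apply/andP; split.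
  by apply: le_trans nx; apply: Fnd; rewrite ?invr_gt0// lef_pV2 ?posrE// ler_nat.
by apply: (le_trans xn); apply: Fnd => //; rewrite ler_nat.
Qed.

(** An increasing bijection of the half-line maps the exhausting segments
    [1/(n+1), n+1] onto segments that still exhaust it. *)
Lemma bigcup_itv_pos (R : realType) (F : R -> R) :
  (forall x y : R, 0 < x -> x <= y -> F x <= F y) ->
  (forall x : R, 0 < x -> 0 < F x) ->
  (forall y : R, 0 < y -> exists2 x : R, 0 < x & F x = y) ->
  \bigcup_n `[F (n.+1%:R)^-1, F n.+1%:R]%classic = `]0, +oo[%classic.
Proof.
move=> Fnd F0 Fsurj; apply/seteqP; split => [x [n _]|y] /=; rewrite !in_itv/= ?andbT.
  by move=> /andP[nx _]; apply: lt_le_trans nx; rewrite F0// invr_gt0.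
move=> /Fsurj[x x0 <-].
(* Such an n is larger than both x and 1/x. *)
have [n xn] : exists n, x + x^-1 < n.+1%:R.
  exists (Num.truncn (x + x^-1)); exact: truncnS_gt.
exists n => //=; rewrite in_itv/=; apply/andP; split; apply: Fnd => //.
- by rewrite -[leRHS]invrK lef_pV2 ?posrE ?invr_gt0// (le_trans _ (ltW xn))// lerDr ltW.
- by rewrite (le_trans _ (ltW xn))// lerDl invr_ge0 ltW.
Qed.

Lemma measurable_fun_pos (R : realType) (G : R -> R) :
  (forall x : R, 0 < x -> {for x, continuous G}) ->
  measurable_fun (`]0, +oo[%classic : set R) G.
Proof.
move=> cG; apply: open_continuous_measurable_fun; first exact: interval_open.
by move=> x; rewrite inE/= in_itv/= andbT; exact: cG.
Qed.

(** Monotone convergence along the exhaustion of the half-line by segments. It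
    reduces integrals over ]0, +oo[ to the calculus theorems on segments; the
    change of variable [F] is kept general for [ge0_substitution_pos]. *)
Lemma ge0_cvg_integral_pos (R : realType) (F G : R -> R) :
  (forall x y : R, 0 < x -> x <= y -> F x <= F y) ->
  (forall x : R, 0 < x -> 0 < F x) ->
  (forall y : R, 0 < y -> exists2 x : R, 0 < x & F x = y) ->
  (forall x : R, 0 < x -> {for x, continuous G}) ->
  (forall x : R, 0 < x -> 0 <= G x) ->
  (\int[lebesgue_measure]_(x in `[(F (n.+1%:R)^-1)%R, (F n.+1%:R)%R]) (G x)%:E @[n --> \oo]
   --> \int[lebesgue_measure]_(x in `]0%R, +oo[) (G x)%:E)%E.
Proof.
move=> Fnd F0 Fsurj cG G0; rewrite -(bigcup_itv_pos Fnd F0 Fsurj).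
have I0 n (x : R) : `[F (n.+1%:R)^-1, F n.+1%:R]%classic x -> 0 < x.
  by rewrite /= in_itv/= => /andP[+ _]; apply: lt_le_trans; rewrite F0// invr_gt0.
apply: ge0_nondecreasing_set_cvg_integral => //.
- exact: itv_pos_nondecreasing.
- move=> n; apply/measurable_EFinP.
  apply: measurable_funS (measurable_fun_pos cG) => //= x /I0.
  by rewrite /= in_itv/= andbT.
- by move=> n x /I0 x0; rewrite lee_fin G0.
Qed.

(** Change of variables on each segment [1/(n+1), n+1], followed by monotone
    convergence on both sides. *)
Lemma ge0_substitution_pos (R : realType) (F F' G : R -> R) :
  (forall x : R, 0 < x -> is_derive x 1 F (F' x)) ->
  (forall x : R, 0 < x -> 0 <= F' x) ->
  (forall x : R, 0 < x -> {for x, continuous F'}) ->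
  (forall x y : R, 0 < x -> x < y -> F x < F y) ->
  (forall x : R, 0 < x -> 0 < F x) ->
  (forall y : R, 0 < y -> exists2 x : R, 0 < x & F x = y) ->
  (forall x : R, 0 < x -> {for x, continuous G}) ->
  (forall x : R, 0 < x -> 0 <= G x) ->
  (\int[lebesgue_measure]_(x in `]0%R, +oo[) (G x)%:E =
   \int[lebesgue_measure]_(x in `]0%R, +oo[) (G (F x) * F' x)%:E)%E.
Proof.
move=> dF F'0 cF' Finc F0 Fsurj cG G0.
have Fnd (x y : R) : 0 < x -> x <= y -> F x <= F y.
  by rewrite le_eqVlt => x0 /predU1P[->//|xy]; rewrite ltW// Finc.
have cF (x : R) : 0 < x -> {for x, continuous F}.
  by move=> x0; apply: differentiable_continuous; apply/derivable1_diffP; case: (dF x x0).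
have DF (x : R) : 0 < x -> derive1 F x = F' x.
  by move=> x0; rewrite derive1E; case: (dF x x0).
have cDF (x : R) : 0 < x -> {for x, continuous (derive1 F)}.
  move=> x0; rewrite /prop_for /continuous_at DF//.
  apply: cvg_trans (cF' x x0); apply: near_eq_cvg; near=> y.
  by rewrite DF//; near: y; exact: lt_nbhsr.
have h := ge0_cvg_integral_pos Fnd F0 Fsurj cG G0.
have id_surj (y : R) : 0 < y -> exists2 x : R, 0 < x & id x = y by exists y.
have h' := @ge0_cvg_integral_pos R id (fun x => G (F x) * F' x)
  (fun x y _ xy => xy) (fun x x0 => x0) id_surj.
rewrite -(cvg_lim _ h)// -(cvg_lim _ (h' _ _))//; last 2 first.
- by move=> x x0; apply: continuousM (cF' _ x0); apply: continuous_comp; [exact: cF|exact/cG/F0].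
- by move=> x x0; rewrite mulr_ge0// ?G0 ?F0 ?F'0.
congr (limn _); apply/funext => n /=.
have n0 : 0 < (n.+1%:R)^-1 :> R by rewrite invr_gt0.
have nle : (n.+1%:R)^-1 <= n.+1%:R :> R.
  by rewrite (@le_trans _ _ 1)// ?invf_le1// ?ler1n.
have I0 (x : R) : x \in `[(n.+1%:R)^-1, n.+1%:R] -> 0 < x.
  by rewrite in_itv/= => /andP[+ _]; exact: lt_le_trans.
have I0' (x : R) : x \in `](n.+1%:R)^-1, n.+1%:R[ -> 0 < x.
  by move=> /subset_itv_oo_cc; exact: I0.
rewrite integration_by_substitution_increasing//.
- by apply: eq_integral => x; rewrite inE => /I0 x0; rewrite /= !fctE DF.
- by move=> x y /I0 x0 /I0 y0; exact: Finc.
- by move=> x /I0' x0; exact: cDF.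
- by apply/cvg_ex; eexists; apply: cvg_at_right_filter; exact: cDF.
- by apply/cvg_ex; eexists; apply: cvg_at_left_filter; apply: cDF.
- split.
  + by move=> x /I0' x0; case: (dF x x0).
  + by apply: cvg_at_right_filter; exact: cF.
  + by apply: cvg_at_left_filter; exact: cF.
- apply: continuous_in_subspaceT => x; rewrite inE/= in_itv/= => /andP[+ _] => h1.
  by apply: cG; apply: lt_le_trans h1; exact: F0.
Unshelve. all: by end_near. Qed.

(** * The Gamma function *)

Lemma is_derive_continuous (R : realType) (F : R -> R) (x d : R) :
  is_derive x 1 F d -> {for x, continuous F}.
Proof. by move=> dF; apply: differentiable_continuous; apply/derivable1_diffP; case: dF. Qed.

Lemma powR_le_expR (R : realType) (c y : R) : 0 < c -> 0 < y -> y `^ c <= expR (c * y).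
Proof.
by move=> c0 y0; rewrite /powR gt_eqF// ler_expR ler_pM2l// ltW// ln_sublinear.
Qed.

(** With y = x/(2c), the inequality y^c <= e^(cy) turns half of the exponential
    decay into a bound on the power. *)
Lemma powR_expR_le (R : realType) (c x : R) : 0 < c -> 0 < x ->
  x `^ c * expR (- x) <= (2 * c) `^ c * expR (- (x / 2)).
Proof.
move=> c0 x0; have c20 : 0 < 2 * c by rewrite mulr_gt0.
have -> : x = 2 * c * (x / (2 * c)) by rewrite mulrCA divff ?mulr1// gt_eqF.
set y := x / (2 * c); have y0 : 0 < y by rewrite divr_gt0.
rewrite (powRM _ (ltW c20) (ltW y0)) -mulrA ler_pM2l ?powR_gt0//.
apply: (@le_trans _ _ (expR (c * y) * expR (- (2 * c * y)))).
  by rewrite ler_pM2r ?expR_gt0// powR_le_expR.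
by rewrite -expRD ler_expR; lra.
Qed.

Lemma cvg_expR_half (R : realType) : expR (- (x / 2)) @[x --> +oo%R] --> (0 : R).
Proof.
apply: (@cvg_comp _ _ _ (fun x : R => x / 2) (fun x => expR (- x)) _ +oo%R).
  by apply: gt0_cvgMly; [rewrite invr_gt0|exact: cvg_id].
exact: cvgr_expR.
Qed.

Lemma integral_expR_half (R : realType) :
  (\int[lebesgue_measure]_(x in `]0%R, +oo[) (expR (- (x / 2)))%:E < +oo :> \bar R)%E.
Proof.
rewrite integral_itv_obnd_cbnd; last first.
  apply/measurable_EFinP; apply: measurableT_comp => //.
  by apply: measurable_funN; exact: mulrr_measurable.
have dF (x : R) : is_derive x 1 (fun x : R => - 2 * expR (- (x / 2))) (expR (- (x / 2))).
  apply: is_derive_eq; rewrite /GRing.scale /=; lra.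
rewrite (@ge0_continuous_FTC2y _ _ (fun x : R => - 2 * expR (- (x / 2))) 0 0).
- by rewrite -EFinB ltry.
- by move=> x _; exact: expR_ge0.
- apply: continuous_subspaceT => x.
  apply: continuous_comp; last exact: continuous_expR.
  by apply: continuousN; apply: continuousM; [exact: cvg_id|exact: cvg_cst].
- rewrite -[X in _ --> X](mulr0 (- 2)); apply: cvgMl_tmp.
  exact: cvg_expR_half.
- by move=> x _; case: (dF x).
- by apply: cvg_at_right_filter; exact: (is_derive_continuous (dF 0)).
- by move=> x _; rewrite derive1E; case: (dF x).
Qed.

Section gamma.
Context {R : realType}.
Implicit Types (b A : R).

Let gam b (x : R) := x `^ (b - 1) * expR (- x).

Let gam_ge0 b x : 0 <= gam b x.
Proof. by rewrite mulr_ge0 ?powR_ge0 ?expR_ge0. Qed.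

Lemma continuous_powR_pos b (x : R) : 0 < x -> {for x, continuous (fun y : R => y `^ b)}.
Proof.
by move=> x0; exact: is_derive_continuous (is_derive1_powR b x0).
Qed.

Lemma continuous_expRN (x : R) : {for x, continuous (fun x : R => expR (- x))}.
Proof. by apply: continuous_comp; [exact: continuousN|exact: continuous_expR]. Qed.

Let continuous_gam b (x : R) : 0 < x -> {for x, continuous (gam b)}.
Proof.
by move=> x0; apply: continuousM; [exact: continuous_powR_pos|exact: continuous_expRN].
Qed.

Let igam b := (\int[lebesgue_measure]_(x in `]0%R, +oo[) (gam b x)%:E)%E.

Let igam_lty b : 1 < b -> (igam b < +oo)%E.
Proof.
move=> b1; have c0 : 0 < b - 1 by rewrite subr_gt0.
apply: (@le_lt_trans _ _ (\int[lebesgue_measure]_(x in `]0%R, +oo[)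
    (((2 * (b - 1)) `^ (b - 1))%:E * (expR (- (x / 2)))%:E))%E).
  apply: ge0_le_integral => //=.
  - by move=> x _; rewrite lee_fin gam_ge0.
  - by apply/measurable_EFinP; apply: measurable_fun_pos => x; exact: continuous_gam.
  - apply/measurable_EFinP; apply: measurable_funM => //; apply: measurableT_comp => //.
    by apply: measurable_funN; exact: mulrr_measurable.
  - by move=> x; rewrite in_itv/= andbT => x0; rewrite -EFinM lee_fin powR_expR_le.
rewrite ge0_integralZl_EFin ?powR_ge0//.
- apply: lte_mul_pinfty => //; rewrite ?lee_fin ?powR_ge0//; exact: integral_expR_half.
- apply/measurable_EFinP; apply: measurableT_comp => //.
  by apply: measurable_funN; exact: mulrr_measurable.
Qed.

Let cvg_powR_expR b (u : R^nat) : 0 < b -> (forall n, 0 < u n) ->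
  u @ \oo --> +oo -> (u n) `^ b * expR (- u n) @[n --> \oo] --> 0.
Proof.
move=> b0 u0 uy.
apply: (@squeeze_cvgr _ _ _ _ (cst 0) (fun n => (2 * b) `^ b * expR (- (u n / 2)))).
- by apply: nearW => n; rewrite mulr_ge0 ?powR_ge0 ?expR_ge0//= powR_expR_le.
- exact: cvg_cst.
- rewrite -[X in _ --> X](mulr0 ((2 * b) `^ b)); apply: cvgMl_tmp.
  exact: (cvg_comp _ _ uy (@cvg_expR_half R)).
Qed.

Let igamS b : 0 < b -> igam (b + 1) = (b%:E * igam b)%E.
Proof.
move=> b0.
have id_surj (y : R) : 0 < y -> exists2 x : R, 0 < x & id x = y by exists y.
have cvgi c := @ge0_cvg_integral_pos R id (gam c) (fun x y _ xy => xy)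
  (fun x x0 => x0) id_surj (@continuous_gam c) (fun x _ => gam_ge0 c x).
pose B n := n.+1%:R `^ b * expR (- n.+1%:R) - (n.+1%:R)^-1 `^ b * expR (- (n.+1%:R)^-1) : R.
have cvgB : B @ \oo --> 0.
  rewrite -[X in _ --> X](subr0 0); apply: cvgB.
    apply: cvg_powR_expR => //.
    have Sy : S @ \oo --> \oo by move=> A [N _ NA]; exists N => // n Nn; apply: NA; exact: leqW.
    exact: (cvg_comp _ _ Sy (@cvgr_idn R)).
  rewrite -[X in _ --> X](mul0r (expR (- 0))).
  have hh : (fun n => (n.+1%:R)^-1) @ \oo --> (0 : R) by exact: cvg_harmonic.
  have h1 : expR (- (n.+1%:R)^-1) @[n --> \oo] --> expR (- (0 : R)).
    by apply: (@cvg_comp _ _ _ (fun n => - (n.+1%:R)^-1) expR _ _ _ (cvgN hh)); exact: continuous_expR.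
  apply: cvgM h1.
  have /cvg_at_rightP := powR_cvg0 b0; by apply; split.
have E n : (b%:E * \int[lebesgue_measure]_(x in `[(n.+1%:R)^-1%R, n.+1%:R%R]) (gam b x)%:E
   = (B n)%:E + \int[lebesgue_measure]_(x in `[(n.+1%:R)^-1%R, n.+1%:R%R]) (gam (b + 1) x)%:E)%E.
  have n0 : 0 < (n.+1%:R)^-1 :> R by rewrite invr_gt0.
  have n1 : (n.+1%:R)^-1 <= n.+1%:R :> R.
    by rewrite (@le_trans _ _ 1)// ?invf_le1// ?ler1n.
  have I0 (x : R) : x \in `[(n.+1%:R)^-1, n.+1%:R] -> 0 < x.
    by rewrite in_itv/= => /andP[+ _]; exact: lt_le_trans.
  have I0' (x : R) : x \in `](n.+1%:R)^-1, n.+1%:R[ -> 0 < x.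
    by move=> /subset_itv_oo_cc; exact: I0.
  move: n1; rewrite le_eqVlt => /predU1P[n1|n1].
    by rewrite /B n1 set_itv1 !integral_set1 subrr mule0 adde0.
  have dE (x : R) : is_derive x 1 (fun x : R => expR (- x)) (- expR (- x)).
    by apply: is_derive_eq; rewrite mulrN1.
  have cDE (x : R) : {for x, continuous (fun x : R => - expR (- x))}.
    by apply: continuousN; exact: continuous_expRN.
  have cG' (x : R) : 0 < x -> {for x, continuous (fun x : R => b * x `^ (b - 1))}.
    by move=> x0; apply: continuousM; [exact: cvg_cst|exact: continuous_powR_pos].
  have := @integration_by_parts R (fun x => expR (- x)) (fun x => x `^ b)
    (fun x => - expR (- x)) (fun x => b * x `^ (b - 1)) _ _ n1.
  set lhs := (X in _ -> _ -> _ -> _ -> _ -> _ -> X = _).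
  have -> : lhs = (b%:E * \int[lebesgue_measure]_(x in `[(n.+1%:R)^-1%R, n.+1%:R%R]) (gam b x)%:E)%E.
    rewrite -ge0_integralZl_EFin//.
    - by apply: eq_integral => x _; rewrite /gam -EFinM mulrCA [X in b * X]mulrC.
    - by move=> x _; rewrite lee_fin gam_ge0.
    - apply/measurable_EFinP.
      apply: measurable_funS (measurable_fun_pos (@continuous_gam b)) => //= x /I0.
      by rewrite /= in_itv/= andbT.
    - exact: ltW.
  set rhs := (X in _ -> _ -> _ -> _ -> _ -> _ -> _ = (_ - X)%E).
  have -> : rhs = (- \int[lebesgue_measure]_(x in `[(n.+1%:R)^-1%R, n.+1%:R%R]) (gam (b + 1) x)%:E)%E.
    rewrite -integral_ge0N => [|x _]; last by rewrite lee_fin gam_ge0.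
    by apply: eq_integral => x _; rewrite /gam addrK -EFinN mulNr mulrC.
  rewrite oppeK /B => ->//.
  - by rewrite [X in X - _]mulrC [X in _ - X]mulrC.
  - by apply: continuous_in_subspaceT => x _; exact: cDE.
  - split; first by move=> x _; case: (dE x).
    + by apply: cvg_at_right_filter; exact: continuous_expRN.
    + by apply: cvg_at_left_filter; exact: continuous_expRN.
  - by move=> x _; rewrite derive1E; case: (dE x).
  - by apply: continuous_in_subspaceT => x; rewrite inE => /I0; exact: cG'.
  - split; first by move=> x /I0' x0; case: (is_derive1_powR b x0).
    + by apply: cvg_at_right_filter; exact: continuous_powR_pos.
    + by apply: cvg_at_left_filter; apply: continuous_powR_pos.
  - by move=> x /I0' x0; rewrite derive1E; case: (is_derive1_powR b x0).
have h1 := cvgeZl (isT : b%:E \is a fin_num) (cvgi b).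
have h2 : ((B n)%:E + \int[lebesgue_measure]_(x in `[(n.+1%:R)^-1%R, n.+1%:R%R])
    (gam (b + 1) x)%:E)%E @[n --> \oo] --> (0%:E + igam (b + 1))%E.
  apply: cvgeD; [by []|exact/cvg_EFin/cvgB/nearW|exact: cvgi].
rewrite add0e in h2; rewrite -(cvg_lim _ h2)// -(cvg_lim _ h1)//.
by congr (limn _); apply/funext => n; rewrite -E.
Qed.

(** The improper integral converges for b > 1 by comparison with e^(-x/2), and
    the functional equation carries this down to 0 < b. *)
Lemma Gamma_fin b : 0 < b ->
  (\int[lebesgue_measure]_(x in `]0%R, +oo[) (x `^ (b - 1) * expR (- x))%:E
   = (Gamma b)%:E)%E.
Proof.
move=> b0; rewrite /Gamma /Rintegral fineK// ge0_fin_numE; last first.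
  by apply: integral_ge0 => x _; rewrite lee_fin gam_ge0.
have : (igam (b + 1) < +oo)%E by apply: igam_lty; rewrite ltrDr.
rewrite igamS//; apply: contraTT; rewrite -!leNgt !leye_eq => /eqP.
by rewrite -/(igam b) => ->; rewrite gt0_muley// lte_fin.
Qed.

(** Integration by parts on [1/(n+1), n+1]; the boundary terms [B n] tend to 0
    at both ends. *)
Lemma GammaS b : 0 < b -> Gamma (b + 1) = b * Gamma b.
Proof.
move=> b0; apply: EFin_inj; rewrite EFinM -!Gamma_fin ?addr_gt0//; exact: igamS.
Qed.

(** The integrand is bounded below by a positive constant on [1, 2]. *)
Lemma Gamma_gt0 b : 0 < b -> 0 < Gamma b.
Proof.
move=> b0; rewrite -lte_fin -Gamma_fin//.
pose c := expR (- (2 * `|b - 1|)) * expR (- 2).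
have c0 : 0 < c by rewrite mulr_gt0 ?expR_gt0.
have cgam (x : R) : 1 <= x -> x <= 2 -> c <= gam b x.
  move=> x1 x2; have x0 : 0 < x by exact: lt_le_trans x1.
  rewrite /gam /powR gt_eqF//; apply: ler_pM; rewrite ?expR_ge0 ?ler_expR ?lerN2//.
  have lx0 := ln_ge0 x1.
  have lx2 : ln x <= 2 by exact: le_trans (ltW (ln_sublinear x0)) x2.
  have h0 := normr_ge0 (b - 1).
  have h1 : - `|b - 1| <= b - 1 by rewrite lerNl -normrN ler_norm.
  nra.
have sub : (`[1, 2]%classic : set R) `<=` `]0%R, +oo[%classic.
  by move=> x /=; rewrite !in_itv/= andbT => /andP[+ _]; exact: lt_le_trans.
have mgam := measurable_fun_pos (@continuous_gam b).
apply: (@lt_le_trans _ _ (\int[lebesgue_measure]_(x in `[1%R, 2%R]) c%:E)%E).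
  rewrite integral_cst//= lebesgue_measure_itv/= lte_fin ltr1n -EFinB -EFinM lte_fin.
  by rewrite mulr_gt0//; lra.
apply: (@le_trans _ _ (\int[lebesgue_measure]_(x in `[1%R, 2%R]) (gam b x)%:E)%E).
  apply: ge0_le_integral => //=.
  - by move=> x _; rewrite lee_fin ltW.
  - by apply/measurable_EFinP; exact: measurable_funS mgam.
  - by move=> x; rewrite in_itv/= => /andP[x1 x2]; rewrite lee_fin cgam.
apply: ge0_subset_integral => //.
- exact/measurable_EFinP.
- by move=> x _; rewrite lee_fin gam_ge0.
Qed.

Lemma integral_expR_Gamma b A : 0 < b -> 0 < A ->
  (\int[lebesgue_measure]_(x in `]0%R, +oo[) (x `^ (b - 1) * expR (- (A * x)))%:E
   = (Gamma b * A `^ (- b))%:E)%E.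
Proof.
move=> b0 A0.
have -> : (Gamma b * A `^ (- b))%:E = (((A `^ (- b))%:E * (Gamma b)%:E)%E).
  by rewrite -EFinM mulrC.
have dF (x : R) : 0 < x -> is_derive x 1 (fun x : R => A * x) (cst A x).
  by move=> x0; apply: is_derive_eq; rewrite /GRing.scale /= mulr1.
rewrite -Gamma_fin// (@ge0_substitution_pos _ (fun x => A * x) (cst A) (gam b) dF)//.
- rewrite -ge0_integralZl_EFin ?powR_ge0//; last 2 first.
  + by move=> x; rewrite /= in_itv/= andbT => x0; rewrite lee_fin mulr_ge0 ?gam_ge0 ?ltW.
  + apply/measurable_EFinP; apply: measurable_fun_pos => x x0; apply: continuousM.
      apply: continuous_comp; first by apply: continuousM; [exact: cvg_cst|exact: cvg_id].
      by apply: continuous_gam; rewrite mulr_gt0.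
    exact: cvg_cst.
  apply: eq_integral => x; rewrite inE/= in_itv/= andbT => x0; rewrite -EFinM; congr (_%:E).
  rewrite /gam powRM ?(ltW A0) ?(ltW x0)//.
  have -> : A `^ (b - 1) = A `^ b * A^-1.
    by rewrite powRB ?(gt_eqF A0) ?implybT// powRr1 ?(ltW A0).
  rewrite powRN; field; rewrite !gt_eqF ?powR_gt0//.
- by move=> x _; exact: ltW.
- by move=> x _; exact: cvg_cst.
- by move=> x y _ xy; rewrite ltr_pM2l.
- by move=> x x0; rewrite mulr_gt0.
- by move=> y y0; exists (y / A); rewrite ?divr_gt0// mulrCA divff ?mulr1// gt_eqF.
- exact: continuous_gam.
Qed.

End gamma.

(** * Gaussian moments for the weight *)

(** Folding the line at 0. It serves both to pass from the line to the
    half-line and to discard the odd part of an integrand without integrating it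
    separately. *)
Lemma ge0_integral_symmetrize (R : realType) (f : R -> \bar R) :
  measurable_fun setT f -> (forall x, (0 <= f x)%E) ->
  (\int[lebesgue_measure]_x f x
   = \int[lebesgue_measure]_(x in `]0%R, +oo[) (f x + f (- x)%R))%E.
Proof.
move=> mf f0.
have mfN : measurable_fun setT (fun x : R => f (- x)%R) by exact: measurableT_comp.
rewrite ge0_integralD//; last 2 first.
- exact: measurable_funTS.
- exact: measurable_funTS.
rewrite -(setUv (`]0%R, +oo[%classic : set R)) ge0_integral_setU//=; last 3 first.
- exact: measurableC.
- by rewrite setUv.
- exact/disj_setPCl.
congr (_ + _)%E; rewrite setCitvr.
rewrite integral_itv_obnd_cbnd; last exact: measurable_funTS.
rewrite (ge0_integration_by_substitution0 mfN)//.
by apply: eq_integral => x _; rewrite opprK.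
Qed.

Lemma measurable_weight (R : realType) (k : R) :
  measurable_fun setT (fun y : R => `|y| `^ (2 * k)).
Proof.
by apply: (measurableT_comp (measurable_powR (2 * k))); exact: normr_measurable.
Qed.

Lemma measurable_expR_sqr (R : realType) (A : R) :
  measurable_fun setT (fun y : R => expR (- (A * y ^+ 2))).
Proof.
apply: measurableT_comp => //; apply: measurable_funN; apply: measurable_funM => //.
Qed.

(** After folding at 0, the substitution y |-> y^2 turns the moment into a
    Gamma integral. *)
Lemma integral_gaussian_moment (R : realType) (k A : R) (m : nat) : 0 <= k -> 0 < A ->
  (\int[lebesgue_measure]_y (expR (- (A * y ^+ 2)) * (y ^+ 2) ^+ m * `|y| `^ (2 * k))%:E
   = (Gamma (m%:R + k + 1 / 2) * A `^ (- (m%:R + k + 1 / 2)))%:E)%E.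
Proof.
move=> k0 A0; set b := m%:R + k + 1 / 2.
have b0 : 0 < b by rewrite /b -addrA ltr_wpDl ?ler0n//; lra.
have mf : measurable_fun setT (fun y : R => expR (- (A * y ^+ 2)) * (y ^+ 2) ^+ m * `|y| `^ (2 * k)).
  apply: measurable_funM (measurable_weight k).
  apply: measurable_funM (measurable_expR_sqr A) _.
  by apply: (measurableT_comp (exprn_measurable m)); exact: exprn_measurable.
have dF (x : R) : 0 < x -> is_derive x 1 (fun x : R => x ^+ 2) (2 * x).
  by move=> x0; apply: is_derive_eq; rewrite /GRing.scale /=; ring.
rewrite ge0_integral_symmetrize; last 2 first.
- exact/measurable_EFinP.
- move=> x; rewrite lee_fin mulr_ge0 ?powR_ge0// mulr_ge0 ?expR_ge0// exprn_ge0 ?sqr_ge0//.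
rewrite -integral_expR_Gamma// (@ge0_substitution_pos _ (fun x => x ^+ 2) (fun x => 2 * x)
  (fun x => x `^ (b - 1) * expR (- (A * x))) dF).
- apply: eq_integral => x; rewrite inE/= in_itv/= andbT => x0.
  rewrite -EFinD; congr (_%:E); rewrite sqrrN normrN gtr0_norm//.
  have E1 : (x ^+ 2) `^ (b - 1) * x = (x ^+ 2) ^+ m * x `^ (2 * k).
    rewrite -[(x ^+ 2) ^+ m]powR_mulrn ?sqr_ge0// -!(powR_mulrn 2 (ltW x0)) -!powRrM.
    rewrite -[X in _ * X = _](powRr1 (ltW x0)) -!powRD ?(gt_eqF x0) ?implybT//.
    by congr (_ `^ _); rewrite /b; lra.
  set e := expR _; rewrite -mulrA -E1; ring.
- by move=> x x0; rewrite mulr_ge0 ?ltW.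
- by move=> x _; apply: continuousM; [exact: cvg_cst|exact: cvg_id].
- by move=> x y x0 xy; rewrite ltr_pXn2r// nnegrE ltW// (lt_trans x0).
- by move=> x x0; rewrite exprn_gt0.
- by move=> y y0; exists (Num.sqrt y); rewrite ?sqrtr_gt0// sqr_sqrtr ?ltW.
- move=> x x0; apply: continuousM; first exact: continuous_powR_pos.
  apply: continuous_comp; last exact: continuous_expR.
  by apply: continuousN; apply: continuousM; [exact: cvg_cst|exact: cvg_id].
- by move=> x _; rewrite mulr_ge0 ?powR_ge0 ?expR_ge0.
Qed.

(** * Explicit Laguerre polynomials and their product formula *)

Section laguerre_explicit.
Context {R : realType}.
Implicit Types (b x : R) (i j m n : nat).

Definition falling b m : R := \prod_(l < m) (b - l%:R).

(** The polynomial factor produced by j derivatives in Rodrigues' formula, by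
    the recurrence of [is_derive_powR_expR_poly]. *)
Fixpoint rodrigues_poly b j : {poly R} :=
  if j is j'.+1 then
    (b - j'%:R) *: rodrigues_poly b j' +
    'X * ((rodrigues_poly b j')^`() - rodrigues_poly b j')
  else 1.

Lemma derive1n_rodrigues_poly b j x : 0 < x ->
  derive1n j (fun y : R => y `^ b * expR (- y)) x =
  x `^ (b - j%:R) * expR (- x) * (rodrigues_poly b j).[x].
Proof.
elim: j x => [|j IH] x x0; first by rewrite derive1n0 subr0 hornerE mulr1.
rewrite derive1nS derive1E.
have := is_derive_powR_expR_poly (b - j%:R) (rodrigues_poly b j) x0.
rewrite -natr1 opprD addrA => -[_ <-].
apply: near_eq_derive; near=> y; apply: IH.
by near: y; exact: lt_nbhsr.
Unshelve. all: by end_near. Qed.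

(** Pascal's rule, after the two contributions to each coefficient are written
    over a common falling factorial. *)
Lemma coef_rodrigues_poly b j i :
  (rodrigues_poly b j)`_i = (-1) ^+ i * 'C(j, i)%:R * falling b (j - i).
Proof.
elim: j i => [|j IH] i.
  rewrite coef1 /falling; case: i => [|i]; last by rewrite bin0n mulr0 mul0r.
  by rewrite bin0 mulr1 mul1r big_ord0.
rewrite /= coefD coefZ coefXM; case: i => [|i] /=.
  rewrite addr0 IH !bin0 !mulr1 !mul1r !subn0 /falling big_ord_recr/=.
  by rewrite mulrC.
rewrite coefB coef_deriv !IH subSS binS natrD exprS.
have [ij|ij] := ltnP i j; last first.
  rewrite (bin_small (ij : (j < i.+1)%N)) !mulr0 !mul0r mul0rn; ring.
have -> : (j - i = (j - i.+1).+1)%N by rewrite subnSK.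
rewrite /falling big_ord_recr/= natrB//.
rewrite -[in X in _ + (X - _)]mulr_natr -!natr1.
ring.
Qed.

Lemma size_rodrigues_poly b j : (size (rodrigues_poly b j) <= j.+1)%N.
Proof.
by apply/leq_sizeP => i ji; rewrite coef_rodrigues_poly bin_small// mulr0 mul0r.
Qed.

End laguerre_explicit.

(** The square of side N + 1 may be summed along the antidiagonals of the
    triangle a + b <= N when the summand vanishes outside of the triangle. *)
Lemma sum_antidiagonal (V : nmodType) (H : nat -> nat -> V) N :
  (forall a b, (N < a + b)%N -> H a b = 0) ->
  \sum_(a < N.+1) \sum_(b < N.+1) H a b = \sum_(i < N.+1) \sum_(a < i.+1) H a (i - a)%N.
Proof.
move=> H0.
transitivity (\sum_(i < N.+1) \sum_(a < N.+1 | (a <= i)%N) H a (i - a)%N); last first.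
  by apply: eq_bigr => i _; rewrite (big_ord_widen _ (fun a => H a (i - a)%N) (ltn_ord i)).
rewrite [RHS](exchange_big_dep xpredT)//=; apply: eq_bigr => a _.
rewrite -(big_geq_mkord a N.+1 xpredT (fun i => H a (i - a)%N)) -(big_mkord xpredT (H a)).
have -> : \sum_(a <= i < N.+1) H a (i - a)%N = \sum_(0 <= i < N.+1 - a) H a (i + a - a)%N.
  by rewrite -(big_addn 0 N.+1 a xpredT (fun i => H a (i - a)%N)) add0n.
rewrite (big_cat_nat (leq0n (N.+1 - a)) (leq_subr _ _))/=.
rewrite [X in _ + X]big_nat [X in _ + X]big1 ?addr0 => [|b /andP[ab _]]; last first.
  by apply: H0; rewrite -leq_subLR.
by apply: eq_bigr => b _; rewrite addnK.
Qed.

Section laguerre_bailey.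
Context {R : realType}.
Context (c : R) (g : nat -> R).
Context (g_gt0 : forall i, 0 < g i) (gS : forall i, g i.+1 = (c + i%:R) * g i).
Implicit Types (a b i j m n M : nat).

(** The Laguerre polynomial L_n^(c-1) when g i = Gamma(i + c). Only the
    functional equation g (i+1) = (c + i) g i and g > 0 matter for the product
    formula, and a shift of [g] is a shift of the parameter. *)
Definition lag (g : nat -> R) n (x : R) : R :=
  \sum_(i < n.+1) (-1) ^+ i * g n / (i`!%:R * (n - i)`!%:R * g i) * x ^+ i.

Lemma falling_ratio n m : falling (c + (n + m)%:R - 1) m * g n = g (n + m).
Proof.
elim: m => [|m IH]; first by rewrite /falling big_ord0 mul1r addn0.
rewrite addnS gS -IH /falling big_ord_recl/= subr0 mulrA; congr (_ * _).
rewrite -natr1 addrA addrK; congr (_ * _); apply: eq_bigr => i _.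
by rewrite /bump /= add1n -natr1; ring.
Qed.

Let g_neq0 i : g i != 0. Proof. exact: lt0r_neq0. Qed.

Let fact_neq0 n : n`!%:R != 0 :> R.
Proof. by rewrite pnatr_eq0 -lt0n fact_gt0. Qed.

(** 1/(a - m)!, with the convention that the inverse factorial of a negative
    integer is 0. The convention makes the recurrences [ifactSl] and [ifactSr] hold
    without side conditions, which is what the telescoping below relies on. *)
Definition ifact a m : R := if (m <= a)%N then ((a - m)`!%:R)^-1 else 0.

Lemma ifactSl a m : (a.+1%:R - m%:R) * ifact a.+1 m = ifact a m.
Proof.
rewrite /ifact; have [ma|am] := leqP m a.
  rewrite leqW// subSn// factS natrM -natrB 1?leqW// subSn//.
  by rewrite invfM mulrA divff ?mul1r ?pnatr_eq0.
case: ifP => [|_]; last by rewrite mulr0.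
by rewrite leq_eqVlt ltnS leqNgt am orbF => /eqP ->; rewrite subrr mul0r.
Qed.

Lemma ifactSr a m : ifact a m.+1 = (a%:R - m%:R) * ifact a m.
Proof.
rewrite /ifact; have [ma|am] := ltnP m a.
  rewrite (ltnW ma) -natrB 1?ltnW// -[(a - m)%N]subnSK// factS natrM.
  by rewrite invfM mulrA divff ?mul1r ?pnatr_eq0.
case: ifP => [ma|_]; last by rewrite mulr0.
by rewrite (@anti_leq a m) ?am ?ma// subrr mul0r.
Qed.

(** A form of the terminating Pfaff-Saalschuetz summation. It goes by induction
    on [a] with a Wilf-Zeilberger certificate: a combination of the summands for
    [a] and [a + 1] is a difference G(m+1) - G(m), and G vanishes at both ends,
    so the sums satisfy the same first-order recurrence as the right-hand side. *)
Lemma saalschuetz n a b M : (a <= n)%N -> (b <= n)%N -> (a < M)%N ->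
  \sum_(0 <= m < M) g (n + m) / (m`!%:R * g m)
     * ifact a m * ifact b m * ifact (n + m) (a + b)
  = n`!%:R * g n * g (a + b)
    / (a`!%:R * b`!%:R * (n - a)`!%:R * (n - b)`!%:R * g a * g b).
Proof.
move=> an bn; elim: a an => [|a IH] an aM.
  rewrite big_ltn// big_nat big1 ?addr0 => [|m /andP[m0 _]]; last first.
    by rewrite /ifact leqn0 (gtn_eqF m0) mulr0 !mul0r.
  rewrite !addn0 add0n subn0 /ifact !leq0n bn !subn0 fact0.
  by field; rewrite !g_neq0 !fact_neq0.
have {IH} IH := IH (ltnW an) (ltnW aM).
pose U m := g (n + m) / (m`!%:R * g m) * ifact a.+1 m * ifact b m * ifact (n + m) (a + b).
(* The certificate. *)
pose G m := - (m%:R * (c + m%:R - 1) * (n%:R + m%:R - a%:R - b%:R)) * U m.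
have GE m : G m.+1 = - (c + n%:R + m%:R) * (a%:R + 1 - m%:R) * (b%:R - m%:R) * U m.
  rewrite /G /U addnS gS !ifactSr.
  rewrite -[ifact (n + m) (a + b)]ifactSl gS factS natrM natrD -!natr1 natrD.
  have cm0 : c + m%:R != 0.
    by apply: contra_neq (g_neq0 m.+1); rewrite gS => ->; rewrite mul0r.
  have m10 : m%:R + 1 != 0 :> R by rewrite natr1 pnatr_eq0.
  by field; rewrite m10 cm0 g_neq0 fact_neq0.
have E m : (a%:R + 1) * (c + a%:R) * ((n%:R + m%:R - a%:R - b%:R) * U m)
   - (n%:R - a%:R) * (c + a%:R + b%:R) * ((a%:R + 1 - m%:R) * U m) = G m.+1 - G m.
  by rewrite GE /G; ring.
have GM : G M = 0.
  by rewrite /G /U /ifact [(M <= a.+1)%N]leqNgt aM mulr0 !mul0r mulr0.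
have G0 : G 0 = 0 by rewrite /G mul0r mul0r oppr0 mul0r.
have : \sum_(0 <= m < M) ((a%:R + 1) * (c + a%:R) * ((n%:R + m%:R - a%:R - b%:R) * U m)
   - (n%:R - a%:R) * (c + a%:R + b%:R) * ((a%:R + 1 - m%:R) * U m)) = 0.
  by under eq_bigr do rewrite E; rewrite telescope_sumr// GM G0 subrr.
rewrite sumrB -!mulr_sumr.
have -> : \sum_(0 <= m < M) ((n%:R + m%:R - a%:R - b%:R) * U m) =
   \sum_(0 <= m < M) g (n + m) / (m`!%:R * g m)
     * ifact a.+1 m * ifact b m * ifact (n + m) (a.+1 + b).
  apply: eq_bigr => m _; rewrite addSn ifactSr !natrD /U; ring.
have -> : \sum_(0 <= m < M) ((a%:R + 1 - m%:R) * U m) =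
   \sum_(0 <= m < M) g (n + m) / (m`!%:R * g m)
     * ifact a m * ifact b m * ifact (n + m) (a + b).
  apply: eq_bigr => m _; rewrite -[ifact a m]ifactSl -natr1 /U; ring.
rewrite IH => /eqP; rewrite subr_eq0 => /eqP H.
have ca0 : c + a%:R != 0.
  by apply: contra_neq (g_neq0 a.+1); rewrite gS => ->; rewrite mul0r.
have a10 : a%:R + 1 != 0 :> R by rewrite natr1 pnatr_eq0.
have na0 : n%:R - a%:R != 0 :> R by rewrite subr_eq0 eqr_nat gtn_eqF.
apply: (mulfI (mulf_neq0 a10 ca0)); rewrite H.
rewrite -[(n - a)%N]subnSK// !factS !natrM subnSK// natrB 1?ltnW// addSn !gS natrD -natr1.
by field; rewrite !g_neq0 !fact_neq0 ca0 na0 a10.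
Qed.

(** Bailey's expansion of a product of Laguerre polynomials of equal degree.
    The coefficient of x^a y^b on the right is a sum over m, evaluated by
    [saalschuetz]; the powers of x + y are put in antidiagonal form by the binomial
    theorem. *)
Lemma lag_mul n x y :
  n`!%:R / g n * lag g n x * lag g n y =
  \sum_(m < n.+1) (x * y) ^+ m / (m`!%:R * g m)
    * lag (fun i => g (i + m.*2)) (n - m) (x + y).
Proof.
pose F m a b := (- 1) ^+ a * (- 1) ^+ b * x ^+ a * y ^+ b / g (a + b)%N *
  (ifact a m * ifact b m * ifact (n + m) (a + b)).
transitivity (\sum_(a < n.+1) \sum_(b < n.+1) \sum_(m < n.+1)
    g (n + m)%N / (m`!%:R * g m) * F m a b).
  rewrite -mulrA mulr_suml mulr_sumr; apply: eq_bigr => -[a /= an] _.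
  rewrite !mulr_sumr; apply: eq_bigr => -[b /= bn] _.
  transitivity ((- 1) ^+ a * (- 1) ^+ b * x ^+ a * y ^+ b / g (a + b)%N *
     \sum_(0 <= m < n.+1) g (n + m) / (m`!%:R * g m)
     * ifact a m * ifact b m * ifact (n + m) (a + b)).
    rewrite (saalschuetz (an : (a <= n)%N) (bn : (b <= n)%N) an).
    by field; rewrite !g_neq0 !fact_neq0.
  by rewrite big_mkord mulr_sumr; apply: eq_bigr => m _; rewrite /F; ring.
under eq_bigr do rewrite exchange_big; rewrite exchange_big /=.
apply: eq_bigr => -[m /=]; rewrite ltnS => mn _.
under eq_bigr do rewrite -mulr_sumr; rewrite -mulr_sumr.
pose H a b := (- 1) ^+ a * (- 1) ^+ b * x ^+ a * y ^+ b /
   (a`!%:R * b`!%:R * g (a + b + m.*2)%N) * ifact (n - m) (a + b).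
transitivity (g (n + m)%N / (m`!%:R * g m) * ((x * y) ^+ m *
  \sum_(a < (n - m).+1) \sum_(b < (n - m).+1) H a b)).
  congr (_ * _); rewrite mulr_sumr.
  rewrite -(big_mkord xpredT (fun a => \sum_(b < n.+1) F m a b)).
  rewrite (big_cat_nat (leq0n m))/=; last exact: leqW.
  rewrite big_nat big1 ?add0r => [|a /andP[_ am]]; last first.
    by apply: big1 => b _; rewrite /F /ifact leqNgt am !mul0r mulr0.
  rewrite -[X in \sum_(X <= _ < _) _]add0n big_addn subSn// big_mkord; apply: eq_bigr => a _.
  rewrite mulr_sumr -(big_mkord xpredT (F m (a + m)%N)).
  rewrite (big_cat_nat (leq0n m))/=; last exact: leqW.
  rewrite big_nat big1 ?add0r => [|b /andP[_ bm]]; last first.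
    by rewrite /F /ifact [(m <= b)%N]leqNgt bm mulr0 mul0r mulr0.
  rewrite -[X in \sum_(X <= _ < _) _]add0n big_addn subSn// big_mkord; apply: eq_bigr => b _.
  rewrite /F /H /ifact !leq_addl !addnK addnACA !exprD exprMn addnA leq_add2r subnDr.
  rewrite -addnA addnn leq_subRL// addnC -subnDA [(m + (a + b))%N]addnC.
  have sgn : (-1) ^+ m * (-1) ^+ m = 1 :> R by rewrite -exprMn mulrNN mulr1 expr1n.
  case: ifP => _; last by rewrite !mulr0.
  have -> : (-1) ^+ a * (-1) ^+ m * ((-1) ^+ b * (-1) ^+ m) = (-1) ^+ a * (-1) ^+ b :> R.
    by rewrite mulrACA sgn mulr1.
  by field; rewrite !g_neq0 !fact_neq0.
rewrite sum_antidiagonal; last first.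
  by move=> a b; rewrite /H /ifact ltnNge => /negbTE ->; rewrite mulr0.
rewrite /lag !mulr_sumr; apply: eq_bigr => -[i /=]; rewrite ltnS => imn _.
have gnm : g (n - m + m.*2) = g (n + m) by rewrite -addnn addnA subnK.
rewrite [x + y]addrC exprDn !mulr_sumr; apply: eq_bigr => -[a /=]; rewrite ltnS => ai _.
have Cia : 'C(i, a)%:R = i`!%:R / (a`!%:R * (i - a)`!%:R) :> R.
  by rewrite -(bin_fact ai) !natrM; field; rewrite !fact_neq0.
rewrite /H subnKC// /ifact imn gnm -(mulr_natr (y ^+ (i - a) * x ^+ a)) Cia -(exprD (-1)) subnKC// exprMn.
by field; rewrite !g_neq0 !fact_neq0.
Qed.
End laguerre_bailey.

(** * The generating function of the Laguerre polynomials *)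

Section laguerre_generating.
Context {R : realType}.
Implicit Types (c r x y z : R).

(** Gamma values along c + nat, as a function of the integer: the weights [g]
    of [lag] for Laguerre polynomials of parameter c - 1. *)
Definition GammaN c (i : nat) : R := Gamma (i%:R + c).

Lemma GammaN_gt0 c i : 0 < c -> 0 < GammaN c i.
Proof. by move=> c0; apply: Gamma_gt0; rewrite ltr_wpDl. Qed.

Lemma GammaNS c i : 0 < c -> GammaN c i.+1 = (c + i%:R) * GammaN c i.
Proof.
move=> c0; have ic0 : 0 < i%:R + c by rewrite ltr_wpDl.
by rewrite /GammaN -natr1 addrAC (GammaS ic0) [c + _]addrC.
Qed.

Lemma GammaN_add c m : (fun i => GammaN c (i + m)) = GammaN (c + m%:R).
Proof. by apply/funext => i; rewrite /GammaN natrD -addrA [c + _]addrC. Qed.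

(** The explicit polynomial agrees with Rodrigues' formula on x > 0, and this
    characterizes the Laguerre polynomial. *)
Lemma laguerreE c n x : 0 < c -> (laguerre (c - 1) n).[x] = lag (GammaN c) n x.
Proof.
move=> c0; set b := n%:R + (c - 1).
rewrite -(@laguerre_unique _ (c - 1) n ((n`!%:R)^-1 *: rodrigues_poly b n)); last first.
  move=> z z0; rewrite /laguerre_rodrigues derive1n_rodrigues_poly// hornerZ.
  rewrite /b addrAC subrr add0r powRN expRN.
  by field; rewrite !gt_eqF ?expR_gt0 ?powR_gt0 ?ltr0n ?fact_gt0.
rewrite hornerZ (horner_coef_wide _ (size_rodrigues_poly b n)) mulr_sumr.
apply: eq_bigr => -[i /=]; rewrite ltnS => ni _.
rewrite coef_rodrigues_poly mulrA; congr (_ * _).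
have gi0 : GammaN c i != 0 by rewrite gt_eqF ?GammaN_gt0.
have f0 j : j`!%:R != 0 :> R by rewrite pnatr_eq0 -lt0n fact_gt0.
have <- : falling b (n - i) * GammaN c i = GammaN c n.
  rewrite -[in RHS](subnKC ni) -(falling_ratio (c := c)) => [|j]; last exact: GammaNS.
  by rewrite subnKC// /b addrCA addrA.
have -> : n`!%:R = 'C(n, i)%:R * (i`!%:R * (n - i)`!%:R) :> R by rewrite -!natrM bin_fact.
by field; rewrite gi0 !f0 pnatr_eq0 -lt0n bin_gt0 ni.
Qed.

Lemma cvg_series_expR z : series (fun i => z ^+ i / i`!%:R) @ \oo --> expR z.
Proof. exact: is_cvg_series_exp_coeff. Qed.

(** The binomial series for (1 - r)^(-c), for real c: expand e^(rx) inside the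
    Gamma integral of x^(c-1) e^(-(1-r)x) and integrate term by term; all terms
    are nonnegative. *)
Lemma cvg_binomial_series c r : 0 < c -> 0 <= r < 1 ->
  series (fun l => r ^+ l * GammaN c l / l`!%:R) @ \oo --> Gamma c * (1 - r) `^ (- c).
Proof.
move=> c0 /andP[r0 r1]; apply/nneseries_EFin_cvg => [l|].
  by rewrite divr_ge0// mulr_ge0 ?exprn_ge0// ltW ?GammaN_gt0.
rewrite -integral_expR_Gamma ?subr_gt0//.
pose f l (x : R) := r ^+ l / l`!%:R * (x `^ (l%:R + c - 1) * expR (- x)).
have f0 l x : 0 <= f l x.
  by rewrite !mulr_ge0 ?expR_ge0 ?powR_ge0 ?exprn_ge0.
have cf l x : 0 < x -> {for x, continuous (fun x : R => x `^ (l%:R + c - 1) * expR (- x))}.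
  by move=> x0; apply: continuousM; [exact: continuous_powR_pos|exact: continuous_expRN].
transitivity (\sum_(l <oo) \int[lebesgue_measure]_(x in `]0%R, +oo[) (f l x)%:E)%E.
  apply: eq_eseriesr => l _; rewrite /f.
  under eq_integral do rewrite EFinM.
  rewrite ge0_integralZl_EFin//.
  - by rewrite Gamma_fin ?ltr_wpDl// -EFinM mulrAC.
  - by move=> x _; rewrite lee_fin mulr_ge0 ?powR_ge0 ?expR_ge0.
  - by apply/measurable_EFinP; apply: measurable_fun_pos => x; exact: cf.
  - by rewrite divr_ge0 ?exprn_ge0.
rewrite -integral_nneseries//.
- apply: eq_integral => x; rewrite inE/= in_itv/= andbT => x0.
  apply/nneseries_EFin_cvg => [l|]; first exact: f0.
  rewrite (_ : (fun l => f l x) = fun l => (x `^ (c - 1) * expR (- x)) * ((r * x) ^+ l / l`!%:R)).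
    have -> : expR (- ((1 - r) * x)) = expR (- x) * expR (r * x).
      by rewrite -expRD; congr expR; ring.
    by rewrite mulrA; apply: cvg_seriesZ; exact: cvg_series_expR.
  apply/funext => l; rewrite /f -(addrA l%:R) (@powRD _ x l%:R) ?(gt_eqF x0) ?implybT//.
  rewrite powR_mulrn ?(ltW x0)// exprMn.
  by ring.
- move=> l; apply/measurable_EFinP; apply: measurable_funM => //.
  by apply: measurable_fun_pos => x; exact: cf.
- by move=> l x _; rewrite lee_fin f0.
Qed.

(** The coefficients of [lag] alternate in sign, so all its terms are
    nonnegative at -|x|, where they have the absolute values that they have at x.
    This provides majorants of the same form as the series to be rearranged. *)
Lemma normr_lag_le (g : nat -> R) n x : (forall i, 0 < g i) ->
  `|lag g n x| <= lag g n (- `|x|).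
Proof.
move=> g0; apply: (le_trans (ler_norm_sum _ _ _)); apply: ler_sum => i _.
rewrite -[X in _ <= X * _](mulrA ((-1) ^+ i)) -[X in `|X * _|](mulrA ((-1) ^+ i)).
set q := (g n / _).
have q0 : 0 <= q by rewrite divr_ge0 ?mulr_ge0// ltW.
rewrite (normrM _ (x ^+ i)) (normrM _ q) normr_sign mul1r normrX (ger0_norm q0) (exprNn `|x|).
rewrite mulrACA -exprMn mulrNN mulr1 expr1n mul1r//.
Qed.

(** Expanding the Laguerre polynomials and summing over j first, each row is a
    binomial series, and the sum of the rows is an exponential series. *)
Lemma cvg_lag_generating c r z : 0 < c -> 0 <= r < 1 ->
  series (fun j => r ^+ j * lag (GammaN c) j z) @ \oo -->
  (1 - r) `^ (- c) * expR (- (z * r / (1 - r))).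
Proof.
move=> c0 r01; have /andP[r0 r1] := r01.
have r10 : 0 < 1 - r by rewrite subr_gt0.
have gi0 i : GammaN c i != 0 by rewrite gt_eqF ?GammaN_gt0.
have f0 j : j`!%:R != 0 :> R by rewrite pnatr_eq0 -lt0n fact_gt0.
(* Majorizing the double series for z is the one for -|z|. *)
pose t z i l := (- (z * r)) ^+ i / i`!%:R / GammaN c i * (r ^+ l * GammaN (c + i%:R) l / l`!%:R).
pose s z i := (1 - r) `^ (- c) * ((- (z * r / (1 - r))) ^+ i / i`!%:R).
have tE : (fun j => r ^+ j * lag (GammaN c) j z) = (fun j => \sum_(i < j.+1) t z i (j - i)%N).
  apply/funext => j; rewrite mulr_sumr; apply: eq_bigr => -[i /=]; rewrite ltnS => ij _.
  have -> : GammaN c j = GammaN (c + i%:R) (j - i).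
    by rewrite -GammaN_add subnK.
  rewrite -[in LHS](subnKC ij) exprD addKn /t; set G := GammaN _ (j - i); rewrite -mulrN mulrN -mulNr exprMn (exprNn z).
  by field; rewrite gi0 !f0.
have trow w i : series (t w i) @ \oo --> s w i.
  have -> : s w i = (- (w * r)) ^+ i / i`!%:R / GammaN c i * (Gamma (c + i%:R) * (1 - r) `^ (- (c + i%:R))).
    rewrite /s [c + i%:R]addrC -/(GammaN c i) opprD powRD ?(gt_eqF r10) ?implybT//.
    rewrite (powRN _ i%:R) powR_mulrn ?(ltW r10)//.
    have -> : - (w * r / (1 - r)) = - (w * r) / (1 - r) by rewrite mulNr.
    rewrite expr_div_n; move: (- (w * r)) => q.
    by field; rewrite gi0 !f0 expf_neq0 ?gt_eqF.
  by apply: cvg_seriesZ; apply: cvg_binomial_series => //; rewrite ltr_wpDr.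
have ssum w : series (s w) @ \oo --> (1 - r) `^ (- c) * expR (- (w * r / (1 - r))).
  by apply: cvg_seriesZ; exact: cvg_series_expR.
rewrite tE; apply: (@cvg_triangular _ (t z) (t (- `|z|)) (s z) (s (- `|z|))) => //.
- move=> i l; rewrite /t; set q := r ^+ l * _ / _.
  have q0 : 0 <= q by rewrite divr_ge0 ?mulr_ge0 ?exprn_ge0// ltW// GammaN_gt0// ltr_wpDr.
  rewrite mulNr opprK normrM (ger0_norm q0) ler_wpM2r// !normrM normrX normrN normrM (ger0_norm r0).
  by rewrite !normfV normr_nat (gtr0_norm (GammaN_gt0 i c0)).
- by apply/cvg_ex; eexists; exact: ssum.
Qed.

End laguerre_generating.

(** * The Hille-Hardy formula *)

Section hille_hardy.
Context {R : realType}.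
Implicit Types (c r w x y z : R).

Definition bessel_coef c (m : nat) : R := (m`!%:R * GammaN c m)^-1.

(** The entire function w^(-(c-1)/2) I_(c-1)(2 sqrt w), where I is the modified
    Bessel function; in this normalization no branch has to be chosen. *)
Definition bessel c w : R := limn (series (fun m => bessel_coef c m * w ^+ m)).

Lemma bessel_coef_gt0 c m : 0 < c -> 0 < bessel_coef c m.
Proof. by move=> c0; rewrite invr_gt0 mulr_gt0 ?GammaN_gt0// ltr0n fact_gt0. Qed.

(** A lower bound uniform in m; the factor 1/2 accounts for the first step
    of the functional equation, where c may be less than 1. *)
Lemma GammaN_ge c m : 1 / 2 <= c -> Gamma c / 2 <= GammaN c m.
Proof.
move=> c12; have c0 : 0 < c by lra.
have G0 := Gamma_gt0 c0.
have E0 : GammaN c 0 = Gamma c by rewrite /GammaN add0r.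
case: m => [|m]; first by rewrite E0; lra.
elim: m => [|m IH]; first by rewrite (GammaNS _ c0) E0 addr0; nra.
apply: (le_trans IH); rewrite (GammaNS m.+1 c0) (ler_peMl (ltW (GammaN_gt0 _ c0)))//.
have m1 : 1 <= m.+1%:R :> R by rewrite ler1n.
by clear -c12 m1; lra.
Qed.

Lemma cvg_series_bessel c w : 1 / 2 <= c ->
  series (fun m => bessel_coef c m * w ^+ m) @ \oo --> bessel c w.
Proof.
move=> c12; have c0 : 0 < c by lra.
apply: normed_cvg.
apply: (@series_le_cvg _ _ (fun m => (2 / Gamma c) * (`|w| ^+ m / m`!%:R))).
- by move=> m; exact: normr_ge0.
- by move=> m; rewrite mulr_ge0 ?divr_ge0 ?exprn_ge0// ltW// Gamma_gt0.
- move=> m /=; rewrite normrM normrX (gtr0_norm (bessel_coef_gt0 m c0)) /bessel_coef invfM.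
  rewrite -[leLHS]mulrA mulrC -[leLHS]mulrA; apply: ler_pM => //.
  + by rewrite invr_ge0 ltW// GammaN_gt0.
  + rewrite -(invf_div (Gamma c) 2) lef_pV2 ?posrE ?GammaN_gt0 ?GammaN_ge//.
    by rewrite divr_gt0 ?Gamma_gt0.
- by apply/cvg_ex; eexists; apply: cvg_seriesZ; exact: cvg_series_expR.
Qed.

(** Bailey's formula turns the left-hand side into a double series summed along
    antidiagonals. Summed by rows, it is a generating function of parameter
    c + 2m for each m, and then the Bessel series. *)
Lemma hille_hardy c r x y : 1 / 2 <= c -> 0 <= r < 1 ->
  series (fun n => r ^+ n * (n`!%:R / GammaN c n * lag (GammaN c) n x * lag (GammaN c) n y))
    @ \oo -->
  (1 - r) `^ (- c) * expR (- ((x + y) * r / (1 - r)))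
    * bessel c (x * y * r / (1 - r) ^+ 2).
Proof.
move=> c12 r01; have c0 : 0 < c by lra.
have /andP[r0 r1] := r01; have r10 : 0 < 1 - r by rewrite subr_gt0.
have gi0 i : GammaN c i != 0 by rewrite gt_eqF ?GammaN_gt0.
have f0 j : j`!%:R != 0 :> R by rewrite pnatr_eq0 -lt0n fact_gt0.
have cm0 m : 0 < c + m.*2%:R by rewrite ltr_wpDr.
pose t w z m j := bessel_coef c m * w ^+ m * (r ^+ j * lag (GammaN (c + m.*2%:R)) j z).
pose s w z m := (1 - r) `^ (- c) * expR (- (z * r / (1 - r))) *
  (bessel_coef c m * (w / (1 - r) ^+ 2) ^+ m).
have trow w z m : series (t w z m) @ \oo --> s w z m.
  have -> : s w z m = bessel_coef c m * w ^+ m *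
      ((1 - r) `^ (- (c + m.*2%:R)) * expR (- (z * r / (1 - r)))).
    rewrite opprD powRD ?(gt_eqF r10) ?implybT// (powRN _ m.*2%:R) powR_mulrn ?(ltW r10)//.
    rewrite /s expr_div_n -exprM mul2n; set e := expR _; set p := _ `^ _.
    by field; rewrite expf_neq0 ?gt_eqF.
  by apply: cvg_seriesZ; exact: cvg_lag_generating.
have ssum w z : series (s w z) @ \oo -->
    (1 - r) `^ (- c) * expR (- (z * r / (1 - r))) * bessel c (w / (1 - r) ^+ 2).
  by apply: cvg_seriesZ; exact: cvg_series_bessel.
rewrite (_ : (fun n => _) = fun n => \sum_(m < n.+1) t (x * y * r) (x + y) m (n - m)%N).
  apply: (@cvg_triangular _ _ (t `|x * y * r| (- `|x + y|)) _ (s `|x * y * r| (- `|x + y|))).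
  - move=> m j; rewrite /t !normrM normrX !normrM normrX.
    rewrite (gtr0_norm (bessel_coef_gt0 m c0)) (ger0_norm r0).
    apply: ler_wpM2l.
      by rewrite mulr_ge0 ?exprn_ge0 ?mulr_ge0// ltW// bessel_coef_gt0.
    rewrite ler_wpM2l ?exprn_ge0//; apply: normr_lag_le => i; exact: GammaN_gt0.
  - by move=> m; exact: trow.
  - by apply/cvg_ex; eexists; exact: ssum.
  - by move=> m; exact: trow.
  - exact: ssum.
apply/funext => n.
rewrite (lag_mul (c := c)) => [|i|i]; last 2 first.
- exact: GammaN_gt0.
- exact: GammaNS.
rewrite mulr_sumr; apply: eq_bigr => -[m /=]; rewrite ltnS => mn _.
rewrite /t GammaN_add -[in LHS](subnKC mn) exprD addKn !exprMn /bessel_coef.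
set l := lag _ _ _.
by field; rewrite gi0 f0.
Qed.
End hille_hardy.

(** * The one-dimensional Dunkl kernel *)

Section dunkl_kernel.
Context {R : realType}.
Implicit Types (k r x y z : R).

(** The power series coefficients of E_k(2z)/Gamma(k + 1/2), where E_k is the
    Dunkl exponential of the line: the even ones and the odd ones are those of
    Bessel functions of consecutive orders. *)
Definition dunkl_coeff k (j : nat) : R :=
  ((j./2)`!%:R * GammaN (k + 1 / 2) (uphalf j))^-1.

Definition dunkl_kernel k z : R :=
  bessel (k + 1 / 2) (z ^+ 2) + z * bessel (k + 3 / 2) (z ^+ 2).

Lemma dunkl_coeff_even k m : dunkl_coeff k m.*2 = bessel_coef (k + 1 / 2) m.
Proof. by rewrite /dunkl_coeff doubleK uphalf_double. Qed.

Lemma dunkl_coeff_odd k m : dunkl_coeff k m.*2.+1 = bessel_coef (k + 3 / 2) m.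
Proof.
rewrite /dunkl_coeff /bessel_coef uphalfE /= !doubleK uphalf_double.
have E : m.+1%:R + (k + 1 / 2) = m%:R + (k + 3 / 2) :> R by rewrite -(natr1 m); lra.
by rewrite /GammaN E.
Qed.

Lemma dunkl_coeff_gt0 k j : 0 <= k -> 0 < dunkl_coeff k j.
Proof.
by move=> k0; rewrite invr_gt0 mulr_gt0 ?ltr0n ?fact_gt0// GammaN_gt0// ltr_wpDl.
Qed.

(** The eigenvalue equation for the Dunkl operator, read on coefficients: this
    operator sends z^j to z^(j-1) times j + 2k for odd j, and times j for even
    j. *)
Lemma dunkl_coeffS k j : 0 <= k ->
  (j.+1%:R + (odd j.+1)%:R * (2 * k)) * dunkl_coeff k j.+1 = 2 * dunkl_coeff k j.
Proof.
move=> k0; have q0 : 0 < k + 1 / 2 by rewrite ltr_wpDl.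
have gi0 i : GammaN (k + 1 / 2) i != 0 by rewrite gt_eqF ?GammaN_gt0.
have f0 i : i`!%:R != 0 :> R by rewrite pnatr_eq0 -lt0n fact_gt0.
rewrite /dunkl_coeff -[in LHS](odd_double_half j) -[in RHS](odd_double_half j).
case: (odd j); rewrite ?add1n ?add0n; move: j./2 => m.
  rewrite !uphalfE /= !doubleK ?uphalf_double factS natrM odd_double /= mul0r addr0.
  have -> : m.*2.+2%:R = m.+1%:R * 2 :> R by rewrite -doubleS -muln2 natrM.
  move: (m.+1%:R) (GammaN _ _) m`!%:R (pnatr_eq0 R m.+1) (gi0 m.+1) (f0 m) => u v w u0 v0 w0.
  by field; rewrite u0 v0 w0.
rewrite !uphalfE /= !doubleK ?uphalf_double odd_double /= (mul1r (2 * k)) (GammaNS _ q0).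
have -> : m.*2.+1%:R = m%:R * 2 + 1 :> R by rewrite -natr1 -muln2 natrM.
have qm0 : k + 1 / 2 + m%:R != 0 by rewrite lt0r_neq0// ltr_wpDr.
have -> : m%:R * 2 + 1 + 2 * k = 2 * (k + 1 / 2 + m%:R) by field.
move: (k + 1 / 2 + m%:R) qm0 (GammaN _ _) m`!%:R (gi0 m) (f0 m) => u u0 v w v0 w0.
by field; rewrite u0 v0 w0.
Qed.

Lemma cvg_dunkl_kernel k z : 0 <= k ->
  series (fun j => dunkl_coeff k j * z ^+ j) @ \oo --> dunkl_kernel k z.
Proof.
move=> k0; apply: cvg_series_interleave.
  rewrite (_ : (fun n => _) = fun m => bessel_coef (k + 1 / 2) m * (z ^+ 2) ^+ m).
    by apply: cvg_series_bessel; lra.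
  by apply/funext => m; rewrite dunkl_coeff_even -exprM mul2n.
rewrite (_ : (fun n => _) = fun m => z * (bessel_coef (k + 3 / 2) m * (z ^+ 2) ^+ m)).
  by apply: cvg_seriesZ; apply: cvg_series_bessel; lra.
by apply/funext => m; rewrite dunkl_coeff_odd -exprM mul2n exprS mulrCA.
Qed.

(** By [dunkl_coeffS] and k >= 0, each quotient of consecutive coefficients is
    at most the one for the exponential series of 2z. *)
Lemma dunkl_coeff_le k j : 0 <= k ->
  dunkl_coeff k j <= (Gamma (k + 1 / 2))^-1 * (2 ^+ j / j`!%:R).
Proof.
move=> k0; elim: j => [|j IH].
  by rewrite /dunkl_coeff /GammaN /= fact0 add0r (mul1r (Gamma _)) expr0 divr1 mulr1.
have j10 : 0 < j.+1%:R :> R by [].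
have -> : 2 ^+ j.+1 / (j.+1)`!%:R = 2 / j.+1%:R * (2 ^+ j / j`!%:R) :> R.
  by rewrite exprS factS natrM invfM mulrACA.
rewrite mulrCA; apply: (@le_trans _ _ (2 / j.+1%:R * dunkl_coeff k j)); last first.
  by rewrite ler_pM2l ?divr_gt0.
rewrite mulrAC ler_pdivlMr// -dunkl_coeffS// mulrC ler_pM2r ?dunkl_coeff_gt0//.
by rewrite lerDl !mulr_ge0.
Qed.

Lemma dunkl_kernel_le k z : 0 <= k ->
  dunkl_kernel k z <= (Gamma (k + 1 / 2))^-1 * expR (2 * `|z|).
Proof.
move=> k0; have h1 := cvg_dunkl_kernel (z := z) k0.
have h2 := cvg_seriesZ (c := (Gamma (k + 1 / 2))^-1) (@cvg_series_expR R (2 * `|z|)).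
apply: (ler_cvg_to h1 h2); apply: nearW => n; apply: ler_sum => j _.
apply: (le_trans (ler_norm _)); rewrite normrM normrX (gtr0_norm (dunkl_coeff_gt0 _ k0)).
rewrite exprMn mulrAC mulrA; apply: ler_wpM2r; first exact: exprn_ge0.
exact: dunkl_coeff_le.
Qed.

(** For positive arguments all the terms are nonnegative. At -w, with w > 0, let
    c_N be the coefficient of w^N in the expansion of e^(2w) times the kernel, and
    let d_N >= 0 be the same coefficient for the kernel at w. The eigenvalue equation
    gives (N + k) c_N = k d_N, a telescoping identity, so that c_N >= 0 too. *)
Lemma dunkl_kernel_ge0 k z : 0 <= k -> 0 <= dunkl_kernel k z.
Proof.
move=> k0; have [z0|z0] := leP 0 z.
  have h := cvg_dunkl_kernel (z := z) k0; apply: (cvgr_to_ge h); apply: nearW => n.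
  by apply: sumr_ge0 => j _; rewrite mulr_ge0 ?exprn_ge0// ltW// dunkl_coeff_gt0.
pose w := - z; have w0 : 0 <= w by rewrite oppr_ge0 ltW.
pose e i : R := 2 ^+ i / i`!%:R.
have e0 i : 0 <= e i by rewrite divr_ge0 ?exprn_ge0.
have eS i : i.+1%:R * e i.+1 = 2 * e i.
  have f0 : i`!%:R != 0 :> R by rewrite pnatr_eq0 -lt0n fact_gt0.
  rewrite /e factS natrM exprS; move: (i.+1%:R) (pnatr_eq0 R i.+1) i`!%:R f0 => u u0 v v0.
  by field; rewrite u0 v0.
pose b := dunkl_coeff k.
pose t u m j := b m * u ^+ m * ((2 * w) ^+ j / j`!%:R).
have trow u m : series (t u m) @ \oo --> b m * u ^+ m * expR (2 * w).
  by apply: cvg_seriesZ; exact: cvg_series_expR.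
have ssum u : series (fun m => b m * u ^+ m * expR (2 * w)) @ \oo
    --> dunkl_kernel k u * expR (2 * w).
  rewrite [X in _ --> X]mulrC (_ : (fun m => _) = fun m => expR (2 * w) * (b m * u ^+ m)).
    by apply: cvg_seriesZ; exact: cvg_dunkl_kernel.
  by apply/funext => m; rewrite mulrC.
have h : series (fun n => \sum_(m < n.+1) t z m (n - m)%N) @ \oo
    --> dunkl_kernel k z * expR (2 * w).
  apply: (@cvg_triangular _ _ (t `|z|) _ (fun m => b m * `|z| ^+ m * expR (2 * w))).
  - move=> m j; rewrite /t !normrM normrX (gtr0_norm (dunkl_coeff_gt0 _ k0)).
    by rewrite normfV normr_nat normrX (ger0_norm (mulr_ge0 (ler0n _ 2) w0)).
  - by move=> m; exact: trow.
  - by apply/cvg_ex; eexists; exact: ssum.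
  - by move=> m; exact: trow.
  - exact: ssum.
suff : 0 <= dunkl_kernel k z * expR (2 * w) by rewrite pmulr_lge0 ?expR_gt0.
apply: (cvgr_to_ge h); apply: nearW => n; apply: sumr_ge0 => N _.
pose cN := \sum_(0 <= m < N.+1) (-1) ^+ m * b m * e (N - m)%N.
pose dN := \sum_(0 <= m < N.+1) b m * e (N - m)%N.
rewrite (_ : \sum_(_ < _) _ = w ^+ N * cN); last first.
  rewrite /cN big_mkord mulr_sumr; apply: eq_bigr => -[m /=]; rewrite ltnS => mN _.
  rewrite /t -[in w ^+ N](subnKC mN) exprD exprMn /e -[z]opprK -/w (exprNn w); ring.
rewrite mulr_ge0 ?exprn_ge0//.
have dN0 : 0 <= dN by apply: sumr_ge0 => m _; rewrite mulr_ge0// ltW// dunkl_coeff_gt0.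
have cdN : (N%:R + k) * cN = k * dN.
  apply/eqP; rewrite -subr_eq0 /cN /dN !mulr_sumr -sumrB.
  pose V m := if m is m'.+1 then (-1) ^+ m' * b m' * ((N%:R - m'%:R) * e (N - m')%N) else 0.
  have -> : \sum_(0 <= i < N.+1) ((N%:R + k) * ((-1) ^+ i * b i * e (N - i)%N)
      - k * (b i * e (N - i)%N)) = \sum_(0 <= i < N.+1) (V i.+1 - V i).
    apply: eq_big_nat => m; rewrite ltnS => /andP[_ mN].
    have -> : V m = - ((-1) ^+ m * ((m%:R + (odd m)%:R * (2 * k)) * b m) * e (N - m)%N).
      case: m mN => [|m] mN; first by rewrite /= mul0r addr0 mul0r mulr0 mul0r oppr0.
      rewrite /V dunkl_coeffS// -natrB 1?ltnW// -[(N - m)%N]subnSK// eS exprS.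
      by rewrite /b; ring.
    rewrite /V -signr_odd; case: (odd m) => /=; rewrite ?expr1 ?expr0; ring.
  by rewrite telescope_sumr// /V subrr mul0r mulr0 subr0.
have [Nk|Nk] := ltP 0 (N%:R + k).
  by rewrite -(pmulr_rge0 _ Nk) cdN mulr_ge0.
have N0 : N = 0%N by apply/eqP; rewrite -(lern0 R); clear -Nk k0; lra.
by rewrite /cN N0 big_nat1 !mul1r mulr_ge0// ltW// dunkl_coeff_gt0.
Qed.
End dunkl_kernel.

(** * Mehler's formula *)

Section mehler.
Context {R : realType}.
Implicit Types (k r x y : R).

Lemma dunkl_hermite_even_mul k j x y : 0 <= k ->
  dunkl_hermite k j.*2 x * dunkl_hermite k j.*2 y =
  expR (- ((x ^+ 2 + y ^+ 2) / 2)) *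
  (j`!%:R / GammaN (k + 1 / 2) j * lag (GammaN (k + 1 / 2)) j (x ^+ 2)
    * lag (GammaN (k + 1 / 2)) j (y ^+ 2)).
Proof.
move=> k0; have q0 : 0 < k + 1 / 2 by rewrite ltr_wpDl.
rewrite /dunkl_hermite /dunkl_hermite_poly odd_double doubleK.
have -> : k - 1 / 2 = k + 1 / 2 - 1 by lra.
rewrite !laguerreE// -addrA -/(GammaN (k + 1 / 2) j) (mulrDl (x ^+ 2)) opprD expRD.
have s2 : (-1) ^+ j * (-1) ^+ j = 1 :> R by rewrite -exprMn mulrNN mulr1 expr1n.
have d0 : 0 <= j`!%:R / GammaN (k + 1 / 2) j by rewrite divr_ge0// ltW// GammaN_gt0.
rewrite -[X in _ = _ * (X * _ * _)](sqr_sqrtr d0).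
set s := (-1) ^+ j in s2 *; set q := Num.sqrt _; set a := expR _; set b := expR _.
set l := lag _ _ _; set l' := lag _ _ _.
transitivity (a * b * (q ^+ 2 * l * l') * (s * s)); first by ring.
by rewrite s2 mulr1.
Qed.

Lemma dunkl_hermite_odd_mul k j x y : 0 <= k ->
  dunkl_hermite k j.*2.+1 x * dunkl_hermite k j.*2.+1 y =
  expR (- ((x ^+ 2 + y ^+ 2) / 2)) * (x * y) *
  (j`!%:R / GammaN (k + 3 / 2) j * lag (GammaN (k + 3 / 2)) j (x ^+ 2)
    * lag (GammaN (k + 3 / 2)) j (y ^+ 2)).
Proof.
move=> k0; have q0 : 0 < k + 3 / 2 by rewrite ltr_wpDl.
rewrite /dunkl_hermite /dunkl_hermite_poly /= odd_double uphalf_double /=.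
have -> : k + 1 / 2 = k + 3 / 2 - 1 by lra.
rewrite !laguerreE// -addrA -/(GammaN (k + 3 / 2) j) (mulrDl (x ^+ 2)) opprD expRD.
have s2 : (-1) ^+ j * (-1) ^+ j = 1 :> R by rewrite -exprMn mulrNN mulr1 expr1n.
have d0 : 0 <= j`!%:R / GammaN (k + 3 / 2) j by rewrite divr_ge0// ltW// GammaN_gt0.
rewrite -[X in _ = _ * (X * _ * _)](sqr_sqrtr d0).
set s := (-1) ^+ j in s2 *; set q := Num.sqrt _; set a := expR _; set b := expR _.
set l := lag _ _ _; set l' := lag _ _ _.
transitivity (a * b * (x * y) * (q ^+ 2 * l * l') * (s * s)); first by ring.
by rewrite s2 mulr1.
Qed.

(** The closed form of sum_n r^n h_n(x) h_n(y). *)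
Definition mehler k r x y : R :=
  (1 - r ^+ 2) `^ (- (k + 1 / 2)) *
  expR (- ((x ^+ 2 + y ^+ 2) * ((1 + r ^+ 2) / (2 * (1 - r ^+ 2))))) *
  dunkl_kernel k (x * y * r / (1 - r ^+ 2)).

Lemma mehler_ge0 k r x y : 0 <= k -> 0 <= mehler k r x y.
Proof. by move=> k0; rewrite !mulr_ge0 ?powR_ge0 ?expR_ge0 ?dunkl_kernel_ge0. Qed.

(** The even and the odd terms are Hille-Hardy series in r^2 with parameters
    k + 1/2 and k + 3/2; they recombine into the two halves of the Dunkl
    kernel. *)
Lemma cvg_mehler k r x y : 0 <= k -> 0 <= r < 1 ->
  series (fun n => r ^+ n * (dunkl_hermite k n x * dunkl_hermite k n y)) @ \oo
    --> mehler k r x y.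
Proof.
move=> k0 /andP[r0 r1].
have r2 : 0 <= r ^+ 2 < 1 by rewrite exprn_ge0//= expr_lt1.
have r20 : 0 < 1 - r ^+ 2 by rewrite subr_gt0; case/andP: r2.
have r2n : 1 - r ^+ 2 != 0 by rewrite gt_eqF.
pose z := x * y * r / (1 - r ^+ 2).
pose E := expR (- ((x ^+ 2 + y ^+ 2) / 2)).
pose E1 := expR (- ((x ^+ 2 + y ^+ 2) * r ^+ 2 / (1 - r ^+ 2))).
have zE : x ^+ 2 * y ^+ 2 * r ^+ 2 / (1 - r ^+ 2) ^+ 2 = z ^+ 2.
  by rewrite /z expr_div_n !exprMn.
have EE : E * E1 = expR (- ((x ^+ 2 + y ^+ 2) * ((1 + r ^+ 2) / (2 * (1 - r ^+ 2))))).
  by rewrite -expRD; congr expR; field.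
pose P := (1 - r ^+ 2) `^ (- (k + 1 / 2)).
have PE : (1 - r ^+ 2) `^ (- (k + 3 / 2)) = P / (1 - r ^+ 2).
  have -> : - (k + 3 / 2) = - (k + 1 / 2) - 1 by lra.
  by rewrite powRB ?(gt_eqF r20) ?implybT// powRr1 ?(ltW r20).
have -> : mehler k r x y = E * (P * E1 * bessel (k + 1 / 2) (z ^+ 2)) +
    r * E * (x * y) * (P / (1 - r ^+ 2) * E1 * bessel (k + 3 / 2) (z ^+ 2)).
  rewrite /mehler -EE -/P /dunkl_kernel -/z.
  move: (bessel _ _) (bessel _ _) => b1 b2; rewrite /z; by field.
apply: cvg_series_interleave.
  rewrite (_ : (fun n => _) = fun j => E * ((r ^+ 2) ^+ j *
      (j`!%:R / GammaN (k + 1 / 2) j * lag (GammaN (k + 1 / 2)) j (x ^+ 2)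
      * lag (GammaN (k + 1 / 2)) j (y ^+ 2)))).
    by apply: cvg_seriesZ; rewrite -zE; apply: hille_hardy => //; lra.
  by apply/funext => j; rewrite dunkl_hermite_even_mul// -exprM mul2n mulrCA.
rewrite (_ : (fun n => _) = fun j => r * E * (x * y) * ((r ^+ 2) ^+ j *
      (j`!%:R / GammaN (k + 3 / 2) j * lag (GammaN (k + 3 / 2)) j (x ^+ 2)
      * lag (GammaN (k + 3 / 2)) j (y ^+ 2)))).
  by apply: cvg_seriesZ; rewrite -zE -PE; apply: hille_hardy => //; lra.
apply/funext => j; rewrite dunkl_hermite_odd_mul// -exprM mul2n exprS -/E.
by move: (_ / _ * _ * _) => q; ring.
Qed.

(** On the diagonal, the growth e^(2|z|) of the Dunkl kernel is absorbed by the
    Gaussian factor, which leaves exp(-x^2 (1-r)/(1+r)). *)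
Lemma mehler_diag_le k r x : 0 <= k -> 0 <= r < 1 ->
  mehler k r x x <=
  (Gamma (k + 1 / 2))^-1 * (1 - r) `^ (- (k + 1 / 2)) * expR (- (x ^+ 2 * ((1 - r) / 2))).
Proof.
move=> k0 /andP[r0 r1].
have r20 : 0 < 1 - r ^+ 2 by rewrite subr_gt0 expr_lt1.
have r10 : 0 < 1 - r by rewrite subr_gt0.
have q0 : 0 < k + 1 / 2 by rewrite ltr_wpDl.
have x2 := sqr_ge0 x.
rewrite /mehler -mulrA mulrC -[leRHS]mulrA [leRHS]mulrCA [leRHS]mulrC.
apply: ler_pM; rewrite ?powR_ge0//.
- by rewrite mulr_ge0 ?expR_ge0 ?dunkl_kernel_ge0.
- rewrite mulrC; apply: (@le_trans _ _ ((Gamma (k + 1 / 2))^-1 *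
      expR (2 * `|x * x * r / (1 - r ^+ 2)|) *
      expR (- ((x ^+ 2 + x ^+ 2) * ((1 + r ^+ 2) / (2 * (1 - r ^+ 2))))))).
    by rewrite ler_pM2r ?expR_gt0// dunkl_kernel_le.
  rewrite -mulrA ler_pM2l ?invr_gt0 ?Gamma_gt0// -expRD ler_expR.
  rewrite -expr2 ger0_norm; last by rewrite divr_ge0 ?(ltW r20)// mulr_ge0.
  have r1p : 0 < 1 + r by rewrite ltr_wpDr.
  have -> : 2 * (x ^+ 2 * r / (1 - r ^+ 2)) -
      (x ^+ 2 + x ^+ 2) * ((1 + r ^+ 2) / (2 * (1 - r ^+ 2)))
      = - (x ^+ 2 * ((1 - r) / (1 + r))).
    by field; rewrite !gt_eqF.
  rewrite lerN2; apply: ler_wpM2l => //; apply: ler_wpM2l; first exact: ltW.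
  by rewrite lef_pV2 ?posrE//; lra.
- rewrite !powRN lef_pV2 ?posrE ?powR_gt0// ge0_ler_powR ?nnegrE ?(ltW q0) ?(ltW r10) ?(ltW r20)//.
  by rewrite lerD2l lerN2 expr2; nra.
Qed.
End mehler.

(** * The mass of the Mehler kernel *)

Section mehler_mass.
Context {R : realType}.
Implicit Types (k r x y : R).

Lemma measurable_dunkl_hermite k n : measurable_fun setT (dunkl_hermite k n).
Proof.
have mL (p : {poly R}) : measurable_fun setT (fun x : R => p.[x ^+ 2]).
  apply: (measurableT_comp (f := horner p)); last exact: exprn_measurable.
  by apply: continuous_measurable_fun; exact: continuous_horner.
apply: measurable_funM.
  apply: measurableT_comp => //; apply: measurable_funN; apply: measurable_funM => //.
rewrite /dunkl_hermite_poly; case: (odd n); last exact: measurable_funM.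
by apply: measurable_funM => //; apply: measurable_funM.
Qed.

Lemma measurable_mehler k r x : 0 <= k -> 0 <= r < 1 ->
  measurable_fun setT (mehler k r x).
Proof.
move=> k0 r01.
apply: (measurable_fun_cvg (h := fun N y =>
  series (fun n => r ^+ n * (dunkl_hermite k n x * dunkl_hermite k n y)) N)).
- move=> N; apply: measurable_sum => n.
  by do 2!apply: measurable_funM => //; exact: measurable_dunkl_hermite.
- by move=> y _; exact: cvg_mehler.
Qed.

(** The kernel may be replaced by its even part in y, which is a power series
    in y^2 times a Gaussian. Its termwise integral is an exponential series, with
    sum (2/(1+r^2))^(k+1/2) times the exponential of a nonpositive number. *)
Lemma integral_mehler_le k r x : 0 <= k -> 0 <= r < 1 ->
  (\int[lebesgue_measure]_y (mehler k r x y * `|y| `^ (2 * k))%:E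
   <= (2 `^ (k + 1 / 2))%:E)%E.
Proof.
move=> k0 r01; have /andP[r0 r1] := r01.
have q0 : 0 < k + 1 / 2 by rewrite ltr_wpDl.
have r20 : 0 < 1 - r ^+ 2 by rewrite subr_gt0 expr_lt1.
have r2p : 0 < 1 + r ^+ 2 by rewrite ltr_wpDr// exprn_ge0.
pose A := (1 + r ^+ 2) / (2 * (1 - r ^+ 2)).
have A0 : 0 < A by rewrite divr_gt0// mulr_gt0.
pose s := x ^+ 2 * r ^+ 2 / (1 - r ^+ 2) ^+ 2.
have s0 : 0 <= s by rewrite divr_ge0 ?sqr_ge0// mulr_ge0 ?sqr_ge0.
pose C := (1 - r ^+ 2) `^ (- (k + 1 / 2)) * expR (- (A * x ^+ 2)).
have C0 : 0 <= C by rewrite mulr_ge0 ?powR_ge0 ?expR_ge0.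
pose w y := `|y| `^ (2 * k).
pose m_ j y := expR (- (A * y ^+ 2)) * (y ^+ 2) ^+ j * w y.
have m0 j y : 0 <= m_ j y by rewrite !mulr_ge0 ?expR_ge0 ?powR_ge0// exprn_ge0// sqr_ge0.
have mm j : measurable_fun setT (m_ j).
  apply: measurable_funM (measurable_weight k).
  apply: measurable_funM (measurable_expR_sqr A) _.
  by apply: (measurableT_comp (exprn_measurable j)); exact: exprn_measurable.
pose g y := C * expR (- (A * y ^+ 2)) * bessel (k + 1 / 2) (s * y ^+ 2) * w y.
have cvg_g y : series (fun j => C * bessel_coef (k + 1 / 2) j * s ^+ j * m_ j y) @ \oo --> g y.
  rewrite (_ : (fun j => _) = fun j => C * expR (- (A * y ^+ 2)) * w y *
      (bessel_coef (k + 1 / 2) j * (s * y ^+ 2) ^+ j)); last first.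
    by apply/funext => j; rewrite /m_ (exprMn _ s); ring.
  rewrite /g -[_ * bessel _ _ * _]mulrAC; apply: cvg_seriesZ; apply: cvg_series_bessel; lra.
have c0 j : 0 <= C * bessel_coef (k + 1 / 2) j * s ^+ j.
  by rewrite mulr_ge0 ?exprn_ge0// mulr_ge0// ltW// bessel_coef_gt0.
have t0 j y : 0 <= C * bessel_coef (k + 1 / 2) j * s ^+ j * m_ j y.
  by rewrite mulr_ge0.
have mt j : measurable_fun setT (fun y => C * bessel_coef (k + 1 / 2) j * s ^+ j * m_ j y).
  by apply: measurable_funM (mm j); exact: measurable_cst.
have mg : measurable_fun setT g.
  apply: (measurable_fun_cvg (h := fun N y =>
    series (fun j => C * bessel_coef (k + 1 / 2) j * s ^+ j * m_ j y) N)) => [N|y _].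
  - by apply: measurable_sum => j; exact: mt.
  - exact: cvg_g.
have g0 y : 0 <= g y.
  by apply: (cvgr_to_ge (cvg_g y)); apply: nearW => N; exact: sumr_ge0.
pose f y := mehler k r x y * w y.
have f0 y : 0 <= f y by rewrite mulr_ge0 ?mehler_ge0 ?powR_ge0.
have mf : measurable_fun setT f.
  by apply: measurable_funM (measurable_weight k); exact: measurable_mehler.
(* The terms odd in y of the Dunkl kernel cancel; [g] is what the even ones leave. *)
have fg y : f y + f (- y) = g y + g (- y).
  have zE : (x * y * r / (1 - r ^+ 2)) ^+ 2 = s * y ^+ 2.
    by rewrite /s expr_div_n !exprMn; ring.
  rewrite /f /g /mehler /dunkl_kernel /w normrN mulrN !mulNr !sqrrN zE.
  have -> : expR (- ((x ^+ 2 + y ^+ 2) * ((1 + r ^+ 2) / (2 * (1 - r ^+ 2)))))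
      = expR (- (A * x ^+ 2)) * expR (- (A * y ^+ 2)).
    by rewrite -expRD; congr expR; rewrite -/A; ring.
  rewrite /C; move: (bessel _ _) (bessel _ _) (_ `^ _) (_ `^ _) (expR _) (expR _).
  by move=> b1 b2 p1 p2 e1 e2; ring.
have -> : (\int[lebesgue_measure]_y (f y)%:E = \int[lebesgue_measure]_y (g y)%:E)%E.
  rewrite !ge0_integral_symmetrize//; last 2 first.
  - exact/measurable_EFinP.
  - exact/measurable_EFinP.
  by apply: eq_integral => y _; rewrite -!EFinD fg.
have -> : (\int[lebesgue_measure]_y (g y)%:E = \int[lebesgue_measure]_y
    (\sum_(j <oo) (C * bessel_coef (k + 1 / 2) j * s ^+ j * m_ j y)%:E))%E.
  apply: eq_integral => y _; apply/esym/nneseries_EFin_cvg => [j|]; first exact: t0.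
  exact: cvg_g.
rewrite integral_nneseries//; last 2 first.
- by move=> j; apply/measurable_EFinP; exact: mt.
- by move=> j y _; rewrite lee_fin t0.
pose D := C * A `^ (- (k + 1 / 2)).
have -> : (\sum_(j <oo) \int[lebesgue_measure]_y
    (C * bessel_coef (k + 1 / 2) j * s ^+ j * m_ j y)%:E
    = \sum_(j <oo) (D * ((s / A) ^+ j / j`!%:R))%:E)%E.
  apply: eq_eseriesr => j _.
  under eq_integral do rewrite EFinM.
  rewrite ge0_integralZl_EFin//; last 2 first.
  - by move=> y _; rewrite lee_fin m0.
  - by apply/measurable_EFinP; exact: mm.
  rewrite integral_gaussian_moment// -EFinM; congr (_%:E).
  rewrite -!addrA -/(GammaN (k + 1 / 2) j) opprD powRD ?(gt_eqF A0) ?implybT//.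
  rewrite (powRN _ j%:R) powR_mulrn ?(ltW A0)// /D /bessel_coef (expr_div_n s).
  have f0' : j`!%:R != 0 :> R by rewrite pnatr_eq0 -lt0n fact_gt0.
  have gi0 : GammaN (k + 1 / 2) j != 0 by rewrite gt_eqF ?GammaN_gt0.
  move: (GammaN _ _) gi0 (A `^ _) => G G0 P.
  by field; rewrite f0' G0 expf_neq0 ?gt_eqF.
have D0 : 0 <= D by rewrite mulr_ge0 ?powR_ge0.
have /nneseries_EFin_cvg -> : series (fun j => D * ((s / A) ^+ j / j`!%:R)) @ \oo
    --> D * expR (s / A).
- by apply: cvg_seriesZ; exact: cvg_series_expR.
- have -> : D * expR (s / A) = ((1 - r ^+ 2) * A) `^ (- (k + 1 / 2))
      * expR (s / A - A * x ^+ 2).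
    by rewrite (powRM _ (ltW r20) (ltW A0)) expRD /D /C; ring.
  have -> : (1 - r ^+ 2) * A = (1 + r ^+ 2) / 2 by rewrite /A; field; rewrite gt_eqF.
  rewrite lee_fin -[leRHS]mulr1; apply: ler_pM; rewrite ?powR_ge0 ?expR_ge0//.
    have h12 : (1 / 2) `^ (k + 1 / 2) * 2 `^ (k + 1 / 2) = 1 :> R.
      by rewrite -powRM// mul1r mulVf// powR1.
    have p12 : 0 < (1 / 2 : R) `^ (k + 1 / 2) by rewrite powR_gt0.
    rewrite powRN -(mulr1_eq h12) lef_pV2 ?posrE ?powR_gt0 ?divr_gt0//.
    rewrite ge0_ler_powR ?nnegrE ?(ltW q0)//; first by rewrite divr_ge0// ltW.
    by rewrite ler_pM2r ?invr_gt0// lerDl exprn_ge0.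
  rewrite -expR0 ler_expR subr_le0 ler_pdivrMr//.
  pose B := r / (1 - r ^+ 2).
  have B0 : 0 <= B by rewrite divr_ge0// ltW.
  have BA : B <= A.
    rewrite /B /A invfM mulrA ler_pM2r ?invr_gt0//.
    by have := sqr_ge0 (1 - r); rewrite sqrrB expr1n mul1r; lra.
  have -> : s = x ^+ 2 * (B * B) by rewrite /s /B; field; rewrite gt_eqF.
  rewrite [A * _]mulrC -[leRHS]mulrA; apply: ler_wpM2l; first exact: sqr_ge0.
  exact: ler_pM.
- by move=> j; rewrite mulr_ge0// divr_ge0// exprn_ge0// divr_ge0// ltW.
Qed.

End mehler_mass.

(** * Growth of the Dunkl-Hermite functions *)

Section growth.
Context {R : realType}.
Implicit Types (k x t : R).

Lemma expR1_ge_expn n : ((n%:R + 2) / (n%:R + 1)) ^+ n <= expR 1 :> R.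
Proof.
have n10 : 0 < n%:R + 1 :> R by rewrite ltr_wpDl.
apply: (@le_trans _ _ (expR (n%:R + 1)^-1 ^+ n)).
  apply: lerXn2r; rewrite ?nnegrE ?expR_ge0//.
  apply: le_trans (expR_ge1Dx _); rewrite le_eqVlt; apply/orP; left; apply/eqP.
  by field; rewrite gt_eqF.
rewrite -expRM_natl ler_expR ler_pdivrMr// mul1r; lra.
Qed.

(** The n-th term of Mehler's series at x = y is at most its sum. The choice
    r = (n+1)/(n+2) keeps r^(-n) below e while 1 - r = 1/(n+2). *)
Lemma dunkl_hermite_gaussian_bound k : 0 <= k ->
  exists2 C : R, 0 <= C & forall n x,
    dunkl_hermite k n x ^+ 2 <=
    C * (n%:R + 2) `^ (k + 1 / 2) * expR (- (x ^+ 2 / (2 * (n%:R + 2)))).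
Proof.
move=> k0; have q0 : 0 < k + 1 / 2 by rewrite ltr_wpDl.
exists (expR 1 / Gamma (k + 1 / 2)) => [|n x].
  by rewrite divr_ge0 ?expR_ge0// ltW// Gamma_gt0.
have n10 : 0 < n%:R + 1 :> R by rewrite ltr_wpDl.
have n20 : 0 < n%:R + 2 :> R by rewrite ltr_wpDl.
pose r : R := (n%:R + 1) / (n%:R + 2).
have r0 : 0 < r by rewrite divr_gt0.
have r01 : 0 <= r < 1 by rewrite ltW//= ltr_pdivrMr// mul1r ltrD2l ltr1n.
have r1 : 1 - r = (n%:R + 2)^-1 by rewrite /r; field; rewrite gt_eqF.
have h := cvg_mehler (x := x) (y := x) k0 r01.
have hn : r ^+ n * (dunkl_hermite k n x * dunkl_hermite k n x) <= mehler k r x x.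
  apply: (series_le_lim (u := fun n => r ^+ n * _)) h => j.
  by rewrite mulr_ge0 ?exprn_ge0 ?(ltW r0)// -expr2 sqr_ge0.
have {hn} := le_trans hn (mehler_diag_le x k0 r01).
rewrite r1 -expr2 mulrC -ler_pdivlMr ?exprn_gt0// => /le_trans; apply.
rewrite -(powR_inv1 (ltW n20)) -powRrM mulN1r opprK (powR_inv1 (ltW n20)).
have -> : x ^+ 2 * ((n%:R + 2)^-1 / 2) = x ^+ 2 / (2 * (n%:R + 2)).
  by field; rewrite gt_eqF.
set e := expR _; set p := _ `^ _; have e0 : 0 <= e by exact: expR_ge0.
have p0 : 0 <= p by exact: powR_ge0.
have -> : (Gamma (k + 1 / 2))^-1 * p * e / r ^+ n
    = ((n%:R + 2) / (n%:R + 1)) ^+ n * ((Gamma (k + 1 / 2))^-1 * p * e).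
  by rewrite mulrC; congr (_ * _); rewrite -exprVn /r invf_div.
have -> : expR 1 / Gamma (k + 1 / 2) * p * e = expR 1 * ((Gamma (k + 1 / 2))^-1 * p * e).
  by rewrite !mulrA.
apply: ler_wpM2r; last exact: expR1_ge_expn.
by rewrite !mulr_ge0// invr_ge0 ltW// Gamma_gt0.
Qed.
(** Both bounds are consequences of the Gaussian bound: its Gaussian factor is
    at most 1, and has a weighted integral that is a power of n + 2. The weight
    n + 2 is at least 1, so that exponents may be increased freely. *)
Lemma dunkl_hermite_growth k : 0 <= k ->
  exists (C : R) (M : nat), 0 <= C /\ forall n,
    (forall x, `|dunkl_hermite k n x| <= C * (n%:R + 2) ^+ M) /\
    (\int[lebesgue_measure]_x (`|dunkl_hermite k n x| * `|x| `^ (2 * k))%:E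
     <= (C * (n%:R + 2) ^+ M)%:E)%E.
Proof.
move=> k0; have q0 : 0 < k + 1 / 2 by rewrite ltr_wpDl.
have [C0 C00 hC0] := dunkl_hermite_gaussian_bound k0.
pose N := (Num.truncn (k + 1 / 2)).+1.
have qN : k + 1 / 2 <= N%:R by rewrite ltW// truncnS_gt.
pose D := Gamma (k + 1 / 2) * 4 `^ (k + 1 / 2).
have D0 : 0 <= D by rewrite mulr_ge0 ?powR_ge0// ltW// Gamma_gt0.
have pn n : 1 <= n%:R + 2 :> R by have := ler0n R n; lra.
have pn0 n : 0 < n%:R + 2 :> R by exact: lt_le_trans (pn n).
have pN n : (n%:R + 2) `^ (k + 1 / 2) <= (n%:R + 2) ^+ N.
  by rewrite -powR_mulrn ?(ltW (pn0 n))// ler_powR.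
have pN1 n : 1 <= (n%:R + 2 : R) ^+ N by rewrite exprn_ege1.
have hb n x : `|dunkl_hermite k n x| <=
    (C0 + 1) * (n%:R + 2) ^+ N * expR (- ((4 * (n%:R + 2))^-1 * x ^+ 2)).
  have b0 : 0 <= (C0 + 1) * (n%:R + 2) ^+ N * expR (- ((4 * (n%:R + 2))^-1 * x ^+ 2)).
    by rewrite !mulr_ge0 ?expR_ge0 ?addr_ge0// exprn_ge0// ltW.
  rewrite -(@ler_pXn2r _ 2) ?nnegrE// real_normK ?num_real//.
  apply: (le_trans (hC0 n x)); rewrite !exprMn -expRM_natl.
  have -> : 2%:R * - ((4 * (n%:R + 2))^-1 * x ^+ 2) = - (x ^+ 2 / (2 * (n%:R + 2))).
    by field; rewrite gt_eqF.
  rewrite ler_wpM2r ?expR_ge0//; apply: ler_pM; rewrite ?powR_ge0//.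
    by nra.
  by apply: (le_trans (pN n)); rewrite expr2 ler_peMr// (le_trans ler01).
exists ((C0 + 1) * (1 + D)), (N + N)%N; split.
  by rewrite mulr_ge0 ?addr_ge0.
move=> n; have C1 : 0 <= C0 + 1 by rewrite addr_ge0.
have pN0 : 0 <= (n%:R + 2 : R) ^+ N by rewrite (le_trans ler01).
split => [x|].
  apply: (le_trans (hb n x)); rewrite exprD -!mulrA ler_wpM2l//.
  have e1 : expR (- ((4 * (n%:R + 2))^-1 * x ^+ 2)) <= 1.
    rewrite -expR0 ler_expR oppr_le0 mulr_ge0 ?sqr_ge0// invr_ge0 mulr_ge0// ltW//.
  apply: (@le_trans _ _ ((n%:R + 2) ^+ N * 1)); first by rewrite ler_wpM2l.
  rewrite mulr1 -[leLHS]mul1r; apply: ler_pM => //; first by rewrite lerDl.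
  by rewrite ler_peMl.
apply: (@le_trans _ _ (\int[lebesgue_measure]_x (((C0 + 1) * (n%:R + 2) ^+ N)%:E *
   (expR (- ((4 * (n%:R + 2))^-1 * x ^+ 2)) * (x ^+ 2) ^+ 0 * `|x| `^ (2 * k))%:E))%E).
  apply: ge0_le_integral => //=.
  - apply/measurable_EFinP; apply: measurable_funM (measurable_weight k).
    by apply: measurableT_comp => //; exact: measurable_dunkl_hermite.
  - apply/measurable_EFinP; apply: measurable_funM => //.
    apply: measurable_funM (measurable_weight k).
    by apply: measurable_funM => //; exact: measurable_expR_sqr.
  - move=> x _; rewrite -EFinM lee_fin expr0 mulr1 mulrA ler_wpM2r ?powR_ge0//.
rewrite ge0_integralZl_EFin//; last 3 first.
- by move=> x _; rewrite lee_fin !mulr_ge0 ?expR_ge0 ?powR_ge0.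
- apply/measurable_EFinP; apply: measurable_funM (measurable_weight k).
  by apply: measurable_funM => //; exact: measurable_expR_sqr.
- by rewrite mulr_ge0.
have p4 : 0 < 4 * (n%:R + 2) :> R by rewrite mulr_gt0.
rewrite integral_gaussian_moment ?invr_gt0// -EFinM lee_fin add0r.
rewrite -(powR_inv1 (ltW p4)) -powRrM mulN1r opprK (powRM _ _ (ltW (pn0 n)))//.
rewrite (mulrA (Gamma _)) -/D exprD.
have -> : (C0 + 1) * (1 + D) * ((n%:R + 2) ^+ N * (n%:R + 2) ^+ N)
    = (C0 + 1) * (n%:R + 2) ^+ N * ((1 + D) * (n%:R + 2) ^+ N) by ring.
by rewrite ler_wpM2l ?mulr_ge0// ler_pM ?powR_ge0// lerDr.
Qed.

Lemma cvg_series_inv_sqr : cvgn (series (fun n => ((n%:R + 2) ^+ 2)^-1 : R)).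
Proof.
apply: (@series_le_cvg _ _ (fun n => (n%:R + 1)^-1 - (n%:R + 2)^-1)).
- by move=> n; rewrite invr_ge0 exprn_ge0// addr_ge0.
- move=> n; rewrite subr_ge0 lef_pV2 ?posrE; first by rewrite lerD2l ler1n.
    by rewrite ltr_wpDl.
  by rewrite ltr_wpDl.
- move=> n; have n10 : 0 < n%:R + 1 :> R by rewrite ltr_wpDl.
  have n20 : 0 < n%:R + 2 :> R by rewrite ltr_wpDl.
  have -> : (n%:R + 1)^-1 - (n%:R + 2)^-1 = ((n%:R + 1) * (n%:R + 2))^-1 :> R.
    by field; rewrite !gt_eqF.
  rewrite lef_pV2 ?posrE ?exprn_gt0 ?mulr_gt0// expr2 ler_pM2r// lerD2l ler1n//.
apply/cvg_ex; exists 1.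
have -> : series (fun n => (n%:R + 1)^-1 - (n%:R + 2)^-1 : R) = fun n => 1 - (n.+1%:R)^-1.
  apply/funext => n; rewrite /series /=.
  rewrite (eq_bigr (fun i => - (i.+2%:R)^-1 - (- (i.+1%:R)^-1 : R))) => [|i _].
    by rewrite (telescope_sumr (fun i => - (i.+1%:R)^-1 : R))// invr1 opprK addrC.
  by rewrite opprK addrC natr1 -[i.+2%:R]natr1 -[i.+1%:R]natr1 -addrA -natrD.
rewrite -[X in _ --> X]subr0; apply: cvgB; first exact: cvg_cst.
exact: cvg_harmonic.
Qed.

Lemma expRN_le_pow (u : R) n : 0 < u -> expR (- u) <= n`!%:R / u ^+ n.
Proof.
move=> u0; case: n => [|n].
  by rewrite expr0 divr1 -expR0 ler_expR oppr_le0 ltW.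
rewrite expRN -invf_div lef_pV2 ?posrE ?expR_gt0 ?divr_gt0 ?exprn_gt0 ?ltr0n ?fact_gt0//.
by apply: le_trans (expR_ge1Dxn n (ltW u0)); rewrite lerDr.
Qed.

(** The exponential of -t sqrt l is below any power of 1/l up to a constant, and
    l is at least (n + 2)/2. *)
Lemma cvg_series_poisson_weight k t M : 0 <= k -> 0 < t ->
  cvgn (series (fun n => expR (- (t * Num.sqrt (2 * n%:R + 2 * k + 1))) * (n%:R + 2) ^+ M)).
Proof.
move=> k0 t0; pose N := (M + 2)%N.
(* With u = t sqrt l, use e^(-u) <= (2N)!/u^(2N), where the exponent N = M + 2
   leaves a factor (n + 2)^(-2). *)
pose K := N.*2`!%:R / t ^+ N.*2 * 2 ^+ N.
have K0 : 0 <= K by rewrite mulr_ge0 ?divr_ge0 ?exprn_ge0// ltW.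
apply: (@series_le_cvg _ _ (fun n => K * ((n%:R + 2) ^+ 2)^-1)).
- by move=> n; rewrite mulr_ge0 ?expR_ge0// exprn_ge0// addr_ge0.
- by move=> n; rewrite mulr_ge0// invr_ge0 exprn_ge0// addr_ge0.
- move=> n; have n20 : 0 < n%:R + 2 :> R by rewrite ltr_wpDl.
  have n0 := ler0n R n.
  set l := 2 * n%:R + 2 * k + 1.
  have l0 : 0 < l by rewrite /l; lra.
  have ln : (n%:R + 2) / 2 <= l by rewrite /l; lra.
  have u0 : 0 < t * Num.sqrt l by rewrite mulr_gt0 ?sqrtr_gt0.
  have n2M := exprn_gt0 M n20.
  apply: (@le_trans _ _ (N.*2`!%:R / (t * Num.sqrt l) ^+ N.*2 * (n%:R + 2) ^+ M)).
    by rewrite ler_pM2r// expRN_le_pow.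
  have -> : (t * Num.sqrt l) ^+ N.*2 = t ^+ N.*2 * l ^+ N.
    by rewrite exprMn; congr (_ * _); rewrite -mul2n exprM sqr_sqrtr ?(ltW l0).
  have key : (n%:R + 2) ^+ M * (n%:R + 2) ^+ 2 <= 2 ^+ N * l ^+ N.
    rewrite -exprD -exprMn; apply: lerXn2r.
    - by rewrite nnegrE ltW.
    - by rewrite nnegrE mulr_ge0// ltW.
    - by clear -ln; lra.
  have lN := exprn_gt0 N l0; have q2 := exprn_gt0 2 n20.
  have tN : 0 <= N.*2`!%:R / t ^+ N.*2 by rewrite divr_ge0// exprn_ge0// ltW.
  rewrite /K invfM mulrA -[leLHS]mulrA -[leRHS]mulrA; apply: ler_wpM2l => //.
  by rewrite mulrC ler_pdivrMr// mulrAC ler_pdivlMr.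
have /cvg_ex[/= S hS] := cvg_series_inv_sqr.
by apply/cvg_ex; eexists; apply: cvg_seriesZ; exact: hS.
Qed.
End growth.

(** * The integral behind subordination *)

Section subordination.
Context {R : realType}.
Implicit Types (b u v : R).

Let Phi v := (\int[lebesgue_measure]_(t in `]-oo, v]) gauss_fun t : R).

Let integrable_gauss (A : set R) : measurable A ->
  (@lebesgue_measure R).-integrable A (EFin \o @gauss_fun R).
Proof.
move=> mA; have h := @integrableT_gauss R.
have g := @integrableS _ _ R (@lebesgue_measure R) setT A _ measurableT mA _ h.
by apply: g.
Qed.

Let dPhi v : is_derive v 1 Phi (gauss_fun v).
Proof.
have vx : v < v + 1 by rewrite ltrDl.
have [] := @continuous_FTC1 R (@gauss_fun R) -oo%O v (v + 1) vx
  (integrable_gauss (measurable_itv _)) (ltNyr v) (@continuous_gauss_fun R v).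
by move=> d e; exact: (DeriveDef d (etrans (esym (derive1E _ _)) e)).
Qed.

(** The limits of the Gaussian distribution function at +oo (for c = true) and
    at -oo (for c = false), along sequences: the indicator functions of ]-oo, u n]
    are eventually constant at each point. *)
Let cvg_Phi (c : bool) (u : R^nat) :
  (forall t, \forall n \near \oo, (t <= u n) = c) ->
  Phi (u n) @[n --> \oo] --> if c then Num.sqrt pi else (0 : R).
Proof.
move=> uc.
pose f_ n : R -> \bar R := (EFin \o @gauss_fun R) \_ [set` `]-oo, u n]].
pose f : R -> \bar R := (EFin \o @gauss_fun R) \_ (if c then setT else set0).
have mf_ n : measurable_fun setT (f_ n : R -> \bar R).
  apply/(measurable_restrictT _ (measurable_itv _)).
  by apply/measurable_EFinP; apply: measurable_funTS; exact: measurable_gauss_fun.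
have mf : measurable_fun setT (f : R -> \bar R).
  have mc : measurable (if c then setT else set0 : set R) by case: (c).
  apply/(measurable_restrictT _ mc).
  by apply/measurable_EFinP; apply: measurable_funTS; exact: measurable_gauss_fun.
have f_E n (x : R) : f_ n x = if x <= u n then (gauss_fun x)%:E else 0%E.
  rewrite /f_ patchE.
  suff -> : (x \in [set` `]-oo, u n]]) = (x <= u n) by [].
  by apply/idP/idP; rewrite inE/= in_itv.
have cf (x : R) : setT x -> f_ ^~ x @ \oo --> f x.
  move=> _; apply: cvg_near_cst; move: (uc x); apply: filterS => n h.
  rewrite f_E h /f patchE; case: (c); first by rewrite in_setT.
  by rewrite in_set0.
have lef n (x : R) : setT x -> (`|f_ n x| <= (EFin \o @gauss_fun R) x)%E.
  move=> _; rewrite f_E; case: ifPn => _ /=; rewrite ?normr0 lee_fin ?gauss_fun_ge0//.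
  by rewrite ger0_norm ?gauss_fun_ge0.
have [_ _ h] := @dominated_convergence _ _ R lebesgue_measure setT measurableT f_ f
   (EFin \o @gauss_fun R) mf_ mf
   (aeW lebesgue_measure cf) (@integrableT_gauss R)
   (aeW lebesgue_measure (fun x n Dx => lef n x Dx)).
have -> : (if c then Num.sqrt pi else (0 : R)) = fine (\int[lebesgue_measure]_x f x)%E.
  rewrite -integral_mkcond; case: (c); last by rewrite integral_set0.
  by rewrite integralT_gauss.
have -> : (fun n => Phi (u n)) = fun n => fine (\int[lebesgue_measure]_x f_ n x)%E.
  by apply: funext => n; rewrite -integral_mkcond.
apply: fine_cvg; rewrite fineK; first by apply: h.
rewrite -integral_mkcond.
by apply: integrable_fin_num; [case: (c)|apply: integrable_gauss; case: (c)].
Qed.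

Lemma continuous_gauss_inv b u : 0 < u ->
  {for u, continuous (fun v : R => expR (- (v ^+ 2 + b ^+ 2 / v ^+ 2)))}.
Proof.
move=> u0; apply: continuous_comp; last exact: continuous_expR.
apply: continuousN; apply: continuousD; first exact: exprn_continuous.
apply: continuousM; first exact: cvg_cst.
apply: continuousV; first by rewrite expf_neq0 ?gt_eqF.
exact: exprn_continuous.
Qed.

(** The integrand has an explicit primitive in terms of the Gaussian
    distribution function Phi, because
    (u -+ b/u)^2 = u^2 + b^2/u^2 -+ 2b, and the derivatives 1 +- b/u^2 of the two
    arguments add up to 2. As u tends to 0, u - b/u tends to -oo, whereas the
    other limits of the two arguments are +oo. *)
Lemma integral_gauss_inv b : 0 < b ->
  (\int[lebesgue_measure]_(u in `]0%R, +oo[) (expR (- (u ^+ 2 + b ^+ 2 / u ^+ 2)))%:E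
   = (Num.sqrt pi / 2 * expR (- (2 * b)))%:E)%E.
Proof.
move=> b0.
(* The primitive. *)
pose W u := 2^-1 * (expR (- (2 * b)) * Phi (u - b / u) + expR (2 * b) * Phi (u + b / u)).
have dinv u : 0 < u -> is_derive u 1 (fun u : R => b / u) (- (b / u ^+ 2)).
  move=> u0.
  have h := is_deriveZ b (@is_deriveV R id u 1 1 (lt0r_neq0 u0) (is_derive_id _ _)).
  apply: is_derive_eq h _; rewrite /GRing.scale /=.
  by rewrite mulr1 mulrN.
pose G u := expR (- (u ^+ 2 + b ^+ 2 / u ^+ 2)).
have dW u : 0 < u -> is_derive u 1 W (G u).
  move=> u0; have di := dinv _ u0.
  have d1 : is_derive u 1 (fun u : R => Phi (u - b / u)) (gauss_fun (u - b / u) * (1 + b / u ^+ 2)).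
    have h := is_deriveB (is_derive_id u 1) di.
    apply: is_derive_eq (is_derive1_comp (dPhi _) h) _.
    by rewrite opprK.
  have d2 : is_derive u 1 (fun u : R => Phi (u + b / u)) (gauss_fun (u + b / u) * (1 - b / u ^+ 2)).
    have h := is_deriveD (is_derive_id u 1) di.
    exact: is_derive_eq (is_derive1_comp (dPhi _) h) _.
  apply: is_derive_eq (is_deriveZ 2^-1 (is_deriveD (is_deriveZ (expR (- (2 * b))) d1) (is_deriveZ (expR (2 * b)) d2))) _.
  rewrite /GRing.scale /= /gauss_fun !mulrA -!expRD.
  have -> : - (2 * b) + - (u - b / u) ^+ 2 = - (u ^+ 2 + b ^+ 2 / u ^+ 2).
    by field; rewrite gt_eqF.
  have -> : 2 * b + - (u + b / u) ^+ 2 = - (u ^+ 2 + b ^+ 2 / u ^+ 2).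
    by field; rewrite gt_eqF.
  by rewrite -/(G u); field; rewrite gt_eqF.
have cG u : 0 < u -> {for u, continuous G} by exact: continuous_gauss_inv.
have G0 u : 0 < u -> 0 <= G u by move=> _; exact: expR_ge0.
have id_surj (y : R) : 0 < y -> exists2 x : R, 0 < x & id x = y by exists y.
have h := @ge0_cvg_integral_pos R id G (fun x y _ xy => xy) (fun x x0 => x0) id_surj cG G0.
rewrite -(cvg_lim _ h)//; apply: cvg_lim => //.
have FTC n : (\int[lebesgue_measure]_(x in `[((n.+2%:R)^-1)%R, (n.+2%:R)%R]) (G x)%:E =
    (W n.+2%:R - W (n.+2%:R)^-1)%:E)%E.
  have n0 : 0 < (n.+2%:R)^-1 :> R by rewrite invr_gt0.
  have n0' : 0 < n.+2%:R :> R by [].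
  rewrite EFinB; apply: continuous_FTC2.
  - by rewrite (@lt_trans _ _ 1)// ?invf_lt1 ?ltr1n.
  - apply: continuous_in_subspaceT => x; rewrite inE/= in_itv/= => /andP[+ _] => h1.
    by apply: cG; apply: lt_le_trans h1.
  - split.
    + move=> x; rewrite in_itv/= => /andP[xn _].
      by case: (dW x (lt_trans n0 xn)).
    + by apply: cvg_at_right_filter; exact: (is_derive_continuous (dW _ n0)).
    + by apply: cvg_at_left_filter; exact: (is_derive_continuous (dW _ n0')).
  - move=> x; rewrite in_itv/= => /andP[xn _].
    by rewrite derive1E; case: (dW x (lt_trans n0 xn)).
rewrite -cvg_shiftS /=.
have -> : (fun n => \int[lebesgue_measure]_(x in `[((n.+2%:R)^-1)%R, (n.+2%:R)%R]) (G x)%:E)%E =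
   fun n => (W n.+2%:R - W (n.+2%:R)^-1)%:E by apply: funext => n; rewrite FTC.
apply: cvg_EFin; first exact: nearW.
have natgt (a : R) : \forall n \near \oo, a <= n.+2%:R.
  near=> n; apply: ltW; apply: lt_le_trans (_ : n%:R <= _); last by rewrite ler_nat 2?ltnW.
  by near: n; exact: nbhs_infty_gtr.
have i0 n : 0 < b * n.+2%:R by rewrite mulr_gt0.
have p1 : Phi (n.+2%:R - b / n.+2%:R) @[n --> \oo] --> Num.sqrt pi.
  apply: (cvg_Phi (c := true)) => t; move: (natgt (t + b)); apply: filterS => n tn.
  rewrite lerBrDr (le_trans _ tn)// lerD2l ler_pdivrMr// ler_peMr ?(ltW b0)//.
  by rewrite ler1n.
have p2 : Phi (n.+2%:R + b / n.+2%:R) @[n --> \oo] --> Num.sqrt pi.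
  apply: (cvg_Phi (c := true)) => t; move: (natgt t); apply: filterS => n tn.
  by rewrite (le_trans tn)// lerDl divr_ge0// ltW.
have p3 : Phi ((n.+2%:R)^-1 - b / (n.+2%:R)^-1) @[n --> \oo] --> (0 : R).
  apply: (cvg_Phi (c := false)) => t; move: (natgt ((2 - t) / b)); apply: filterS => n.
  rewrite ler_pdivrMr// invrK => tn; apply/negbTE; rewrite -ltNge.
  have : (n.+2%:R)^-1 <= 1 :> R by rewrite invf_le1// ler1n.
  by move: tn; rewrite mulrC; move: (b * _) (_^-1) => y z; lra.
have p4 : Phi ((n.+2%:R)^-1 + b / (n.+2%:R)^-1) @[n --> \oo] --> Num.sqrt pi.
  apply: (cvg_Phi (c := true)) => t; move: (natgt (t / b)); apply: filterS => n.
  rewrite ler_pdivrMr// invrK mulrC => tn.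
  by rewrite (le_trans tn)// lerDr invr_ge0.
have lim2 (f g : R^nat) (A B : R) : f @ \oo --> A -> g @ \oo --> B ->
    2^-1 * (expR (- (2 * b)) * f n + expR (2 * b) * g n) @[n --> \oo] -->
    2^-1 * (expR (- (2 * b)) * A + expR (2 * b) * B).
  by move=> fA gB; apply: cvgMl_tmp; apply: cvgD; apply: cvgMl_tmp.
rewrite [X in _ --> X](_ : _ =
  2^-1 * (expR (- (2 * b)) * Num.sqrt pi + expR (2 * b) * Num.sqrt pi) -
  2^-1 * (expR (- (2 * b)) * 0 + expR (2 * b) * Num.sqrt pi)).
  exact: cvgB (lim2 _ _ _ _ p1 p2) (lim2 _ _ _ _ p3 p4).
by move: (expR _) (expR _) (Num.sqrt _) => x y z; field.
Unshelve. all: by end_near. Qed.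
End subordination.

(** * Rapidly decreasing multipliers of Dunkl-Hermite expansions *)

Section rapid_weights.
Context {R : realType}.
Implicit Types (k x y t c : R) (e : R^nat).

(** Multipliers for which the growth of the Dunkl-Hermite functions is
    harmless: they apply both to e^(-t sqrt l_n) and to r^n. *)
Definition rapidly_decreasing e :=
  (forall n, 0 <= e n) /\ forall M, cvgn (series (fun n => e n * (n%:R + 2) ^+ M)).

Lemma cvgn_series_rapid e (v : R^nat) A M : rapidly_decreasing e ->
  (forall n, `|v n| <= e n * (A * (n%:R + 2) ^+ M)) -> cvgn (series v).
Proof.
move=> [e0 cvge] vle.
apply: normed_cvg; apply: (series_le_cvg _ _ vle) => [n|n|].
- exact: normr_ge0.
- exact: le_trans (vle n).
- rewrite (_ : (fun n => _) = fun n => A * (e n * (n%:R + 2) ^+ M)).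
    exact: cvgP _ (cvg_seriesZ (c := A) (cvge M)).
  by apply: funext => n; rewrite mulrCA.
Qed.

Lemma rapidly_decreasing_poisson k t : 0 <= k -> 0 < t ->
  rapidly_decreasing (fun n => expR (- (t * Num.sqrt (2 * n%:R + 2 * k + 1)))).
Proof. by move=> k0 t0; split=> [n|M]; [exact: expR_ge0|exact: cvg_series_poisson_weight]. Qed.

(** Compared with the Poisson multipliers for k = 0, since sqrt(2n + 1) is at
    most n + 1. *)
Lemma rapidly_decreasing_heat c : 0 < c ->
  rapidly_decreasing (fun n => expR (- c) ^+ n).
Proof.
move=> c0; split=> [n|M]; first by rewrite exprn_ge0// expR_ge0.
have cw := @cvg_series_poisson_weight R 0 c M (lexx 0) c0.
apply: (series_le_cvg _ _ _ (cvgP _ (cvg_seriesZ (c := expR c) cw))) => n.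
- by rewrite mulr_ge0 ?exprn_ge0 ?expR_ge0 ?addr_ge0.
- by rewrite !mulr_ge0 ?exprn_ge0 ?expR_ge0 ?addr_ge0.
rewrite mulrA ler_wpM2r// ?exprn_ge0 ?addr_ge0//.
rewrite -expRM_natl -expRD ler_expR mulr0 addr0 mulrN -mulr_natl lerNl.
have n1 : 0 <= n%:R + 1 :> R by rewrite addr_ge0.
have : Num.sqrt (2 * n%:R + 1) <= n%:R + 1 :> R.
  rewrite -[leRHS]ger0_norm// -sqrtr_sqr ler_wsqrtr//.
  by rewrite sqrrD expr1n mulr1 lerD2r mulr_natl lerDr exprn_ge0.
move=> /(ler_wpM2l (ltW c0)); rewrite mulrDr => h.
by rewrite mulr1 [_ * c]mulrC in h *; lra.
Qed.

Lemma measurable_dunkl_coef_integrand k (g : R -> R) n :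
  measurable_fun setT g -> measurable_fun setT (dunkl_coef_integrand k g n).
Proof.
move=> mg; apply: measurable_funM (measurable_weight k).
by apply: measurable_funM => //; exact: measurable_dunkl_hermite.
Qed.

Lemma integrable_dunkl_coef_integrand k (g : R -> R) n (r : R) :
  measurable_fun setT g ->
  (\int[lebesgue_measure]_y `|dunkl_coef_integrand k g n y|%:E <= r%:E)%E ->
  (@lebesgue_measure R).-integrable setT (EFin \o dunkl_coef_integrand k g n).
Proof.
move=> mg gle; apply/integrableP; split.
  by apply/measurable_EFinP; exact: measurable_dunkl_coef_integrand.
exact: le_lt_trans gle (ltry _).
Qed.

Lemma norm_dunkl_coef_le k (g : R -> R) n (r : R) :
  measurable_fun setT g ->
  (\int[lebesgue_measure]_y `|dunkl_coef_integrand k g n y|%:E <= r%:E)%E ->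
  `|dunkl_coef k g n| <= r.
Proof.
move=> mg gle; have ig := integrable_dunkl_coef_integrand mg gle.
rewrite -lee_fin; apply: le_trans gle.
rewrite /dunkl_coef /Rintegral -abse_EFin fineK; last exact: integrable_fin_num.
by apply: le_abse_integral => //; case/integrableP: ig.
Qed.

(** Term by term integration of the kernel series against g times the weight.
    It is used for the Poisson kernel with g = f and g = 1, and for the Mehler
    kernel with g = 1. *)
Lemma cvg_series_poisson_term e k x (g S : R -> R) A N : 0 <= k ->
  rapidly_decreasing e -> measurable_fun setT g ->
  (forall n, (\int[lebesgue_measure]_y `|dunkl_coef_integrand k g n y|%:E
              <= (A * (n%:R + 2) ^+ N)%:E)%E) ->
  (forall y, series (fun n => e n * (dunkl_hermite k n x * dunkl_hermite k n y)) @ \oo --> S y) ->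
  (@lebesgue_measure R).-integrable setT (EFin \o (fun y => S y * g y * `|y| `^ (2 * k))) /\
  series (fun n => e n * dunkl_coef k g n * dunkl_hermite k n x) @ \oo -->
    \int[lebesgue_measure]_y (S y * g y * `|y| `^ (2 * k)).
Proof.
move=> k0 re mg gle eS.
have [C [M [C0 growth]]] := dunkl_hermite_growth k0.
have e0 := re.1.
pose f n y := e n * dunkl_hermite k n x * dunkl_coef_integrand k g n y.
pose b n := e n * (C * A * (n%:R + 2) ^+ (M + N)).
have mf n : measurable_fun setT (f n).
  by apply: measurable_funM => //; exact: measurable_dunkl_coef_integrand.
have If n : (\int[lebesgue_measure]_y `|f n y|%:E <= (b n)%:E)%E.
  under eq_integral do rewrite normrM EFinM.
  rewrite ge0_integralZl_EFin//; last first.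
    by apply/measurable_EFinP; apply: measurableT_comp => //; exact: measurable_dunkl_coef_integrand.
  apply: le_trans (_ : _ <= (`|e n * dunkl_hermite k n x|)%:E * (A * (n%:R + 2) ^+ N)%:E)%E _.
    by apply: lee_pmul => //; apply: integral_ge0 => y _; rewrite lee_fin.
  have A0 : 0 <= A * (n%:R + 2) ^+ N.
    by rewrite -lee_fin; apply: le_trans (gle n); apply: integral_ge0 => y _; rewrite lee_fin.
  rewrite -EFinM lee_fin normrM (ger0_norm (e0 n)) /b -mulrA ler_wpM2l//.
  by rewrite exprD mulrACA; apply: ler_wpM2r => //; have [] := growth n.
have cb : cvgn (series b).
  apply: (cvgn_series_rapid (A := `|C * A|) (M := (M + N)%N) re) => n.
  rewrite normrM (ger0_norm (e0 n)) ler_wpM2l// normrM ler_wpM2l//.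
  by rewrite ger0_norm// exprn_ge0// addr_ge0.
have fS y : setT y -> series (f ^~ y) @ \oo --> S y * g y * `|y| `^ (2 * k).
  move=> _; have := cvg_seriesZ (c := g y * `|y| `^ (2 * k)) (eS y).
  rewrite [_ * S y]mulrC mulrA (_ : (fun n => _) = f ^~ y)//.
  by apply: funext => n; rewrite /f /dunkl_coef_integrand; ring.
have [h1 h2] := @cvg_series_integral _ _ R lebesgue_measure setT f _ b measurableT mf If cb fS.
split => //; move: h2; rewrite (_ : (fun n => _) = (fun n => e n * dunkl_coef k g n * dunkl_hermite k n x))//.
apply: funext => n; rewrite RintegralZl//; first by rewrite mulrAC.
exact: integrable_dunkl_coef_integrand (gle n).
Qed.
End rapid_weights.

(** * The Poisson kernel *)

Section poisson_kernel.
Context {R : realType}.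
Implicit Types (k x y t u l : R).

Let freq k (n : nat) : R := 2 * n%:R + 2 * k + 1.

Let freq_gt0 k n : 0 <= k -> 0 < freq k n.
Proof. by move=> k0; rewrite ltr_wpDl// addr_ge0 ?mulr_ge0. Qed.

(** The density in u of the subordination formula, times e^(-s l) at
    s = t^2/(4u^2). *)
Definition subordinator t l u : R :=
  2 / Num.sqrt pi * (expR (- u ^+ 2) * expR (- (t ^+ 2 / (4 * u ^+ 2) * l))).

Lemma subordinator_ge0 t l u : 0 <= subordinator t l u.
Proof. by rewrite !mulr_ge0 ?expR_ge0 ?invr_ge0 ?sqrtr_ge0. Qed.

Lemma measurable_subordinator t l :
  measurable_fun (`]0, +oo[%classic : set R) (subordinator t l).
Proof.
apply: measurable_fun_pos => u u0; apply: continuousM; first exact: cvg_cst.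
apply: continuousM.
  apply: continuous_comp; last exact: continuous_expR.
  by apply: continuousN; exact: exprn_continuous.
apply: continuous_comp; last exact: continuous_expR.
apply: continuousN; apply: continuousM; last exact: cvg_cst.
apply: continuousM; first exact: cvg_cst.
apply: continuousV; first by rewrite mulf_neq0 ?expf_neq0 ?gt_eqF.
by apply: continuousM; [exact: cvg_cst|exact: exprn_continuous].
Qed.

Lemma integral_subordinator t l : 0 < t -> 0 < l ->
  (\int[lebesgue_measure]_(u in `]0%R, +oo[) (subordinator t l u)%:E
   = (expR (- (t * Num.sqrt l)))%:E)%E.
Proof.
move=> t0 l0; have spi : 0 < Num.sqrt pi :> R by rewrite sqrtr_gt0 pi_gt0.
pose b := t * Num.sqrt l / 2.
have b0 : 0 < b by rewrite divr_gt0 ?mulr_gt0 ?sqrtr_gt0.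
pose G u := expR (- (u ^+ 2 + b ^+ 2 / u ^+ 2)).
have cG u : 0 < u -> {for u, continuous G} by exact: continuous_gauss_inv.
transitivity (\int[lebesgue_measure]_(u in `]0%R, +oo[) ((2 / Num.sqrt pi)%:E * (G u)%:E))%E.
  apply: eq_integral => u; rewrite inE/= in_itv/= andbT => u0.
  rewrite -EFinM; congr (_%:E).
  rewrite /subordinator -expRD; congr (_ * expR _).
  rewrite /b !exprMn sqr_sqrtr ?(ltW l0)//.
  by field; rewrite gt_eqF.
rewrite ge0_integralZl_EFin//.
- rewrite integral_gauss_inv// -EFinM; congr (_%:E).
  have -> : 2 * b = t * Num.sqrt l by rewrite /b mulrC divfK.
  by move: (expR _) => z; field; rewrite gt_eqF.
- by move=> u _; rewrite lee_fin expR_ge0.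
- by apply/measurable_EFinP; exact: measurable_fun_pos cG.
Qed.

Let ratio t u : R := expR (- (t ^+ 2 / (2 * u ^+ 2))).

Let ratio01 t u : 0 < t -> 0 < u -> 0 <= ratio t u < 1.
Proof.
move=> t0 u0; rewrite expR_ge0/= -expR0 ltr_expR oppr_lt0.
by rewrite divr_gt0 ?mulr_gt0 ?exprn_gt0.
Qed.

Let subordinator_freq k t u n : 0 < u ->
  subordinator t (freq k n) u = subordinator t (2 * k + 1) u * ratio t u ^+ n.
Proof.
move=> u0; rewrite /subordinator -(mulrA (2 / _)) -(mulrA (expR (- u ^+ 2))); congr (_ * (_ * _)).
rewrite /ratio -expRM_natl -expRD; congr expR.
by rewrite /freq -mulr_natl; field; rewrite gt_eqF.
Qed.

Let decay t k (n : nat) : R := expR (- (t * Num.sqrt (freq k n))).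

Let cvgn_abs_kernel k t x y : 0 <= k -> 0 < t ->
  cvgn (series (fun n => decay t k n * `|dunkl_hermite k n x * dunkl_hermite k n y|)).
Proof.
move=> k0 t0; have [C [M [C0 growth]]] := dunkl_hermite_growth k0.
have re := rapidly_decreasing_poisson k0 t0.
apply: (cvgn_series_rapid (A := C ^+ 2) (M := (M + M)%N) re) => n.
rewrite normrM (ger0_norm (re.1 n)) normr_id ler_wpM2l ?(re.1 n)// normrM.
rewrite (exprD _ M M) mulrACA; apply: ler_pM => //.
  by have [] := growth n.
by have [] := growth n.
Qed.

Definition poisson_kernel k t x y : R :=
  limn (series (fun n => decay t k n * (dunkl_hermite k n x * dunkl_hermite k n y))).

Lemma cvg_poisson_kernel k t x y : 0 <= k -> 0 < t ->
  series (fun n => decay t k n * (dunkl_hermite k n x * dunkl_hermite k n y)) @ \oo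
    --> poisson_kernel k t x y.
Proof.
move=> k0 t0; apply: normed_cvg.
rewrite (_ : [normed _] = series (fun n => decay t k n * `|dunkl_hermite k n x * dunkl_hermite k n y|)).
  exact: cvgn_abs_kernel.
by congr series; apply: funext => n; rewrite /= normrM [`|decay t k n|]ger0_norm ?expR_ge0.
Qed.

Lemma poisson_kernel_sym k t x y : poisson_kernel k t x y = poisson_kernel k t y x.
Proof.
rewrite /poisson_kernel; congr (limn (series _)); apply: funext => n.
by rewrite [dunkl_hermite k n x * _]mulrC.
Qed.

(** Averages over u commute with the summation over n. This applies with
    v_n = h_n(x) h_n(y), and with v_n = h_n(x) times the weighted integral of
    h_n. *)
Lemma cvg_series_subordinated k t (v : R^nat) (F : R -> R) : 0 <= k -> 0 < t ->
  cvgn (series (fun n => decay t k n * `|v n|)) ->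
  (forall u, 0 < u -> series (fun n => subordinator t (freq k n) u * v n) @ \oo --> F u) ->
  (@lebesgue_measure R).-integrable `]0%R, +oo[ (EFin \o F) /\
  series (fun n => decay t k n * v n) @ \oo --> \int[lebesgue_measure]_(u in `]0%R, +oo[) F u.
Proof.
move=> k0 t0 cv vF.
pose f n u := subordinator t (freq k n) u * v n.
have mf n : measurable_fun (`]0, +oo[%classic : set R) (f n).
  by apply: measurable_funM => //; exact: measurable_subordinator.
have sI n := integral_subordinator t0 (freq_gt0 n k0).
have msub n : measurable_fun (`]0, +oo[%classic : set R) (EFin \o subordinator t (freq k n)).
  by apply/measurable_EFinP; exact: measurable_subordinator.
have fI n : (\int[lebesgue_measure]_(u in `]0%R, +oo[) `|f n u|%:E <= (decay t k n * `|v n|)%:E)%E.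
  under eq_integral do rewrite normrM (ger0_norm (subordinator_ge0 _ _ _)) mulrC EFinM.
  rewrite ge0_integralZl_EFin//.
  - by rewrite sI -EFinM mulrC.
  - by move=> u _; rewrite lee_fin subordinator_ge0.
  - exact: msub.
have fF u : `]0, +oo[%classic u -> series (f ^~ u) @ \oo --> F u.
  by rewrite /= in_itv/= andbT => /vF.
have [h1 h2] := @cvg_series_integral _ _ R lebesgue_measure `]0%R, +oo[%classic f _ _
   (measurable_itv _) mf fI cv fF.
split => //; move: h2; rewrite (_ : (fun n => _) = (fun n => decay t k n * v n))//.
apply: funext => n; rewrite RintegralZr//.
  by rewrite /Rintegral sI.
apply/integrableP; split; first exact: msub.
under eq_integral do rewrite /= (ger0_norm (subordinator_ge0 _ _ _)).
by rewrite sI ltry.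
Qed.

Let cvg_heat k t x y u : 0 <= k -> 0 < t -> 0 < u ->
  series (fun n => subordinator t (freq k n) u * (dunkl_hermite k n x * dunkl_hermite k n y)) @ \oo
    --> subordinator t (2 * k + 1) u * mehler k (ratio t u) x y.
Proof.
move=> k0 t0 u0.
have := cvg_seriesZ (c := subordinator t (2 * k + 1) u) (cvg_mehler (x := x) (y := y) k0 (ratio01 t0 u0)).
rewrite (_ : (fun n => _) = fun n => subordinator t (freq k n) u *
  (dunkl_hermite k n x * dunkl_hermite k n y))//.
by apply: funext => n; rewrite (subordinator_freq _ _ _ u0) -mulrA.
Qed.

(** The Poisson kernel is an average of Mehler kernels with nonnegative
    weights. *)
Lemma poisson_kernel_ge0 k t x y : 0 <= k -> 0 < t -> 0 <= poisson_kernel k t x y.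
Proof.
move=> k0 t0.
have heat u (u0 : 0 < u) := cvg_heat (x := x) (y := y) k0 t0 u0.
have [_ h] := cvg_series_subordinated k0 t0 (@cvgn_abs_kernel k t x y k0 t0) heat.
rewrite (cvg_unique _ (cvg_poisson_kernel (x := x) (y := y) k0 t0) h)//.
apply: Rintegral_ge0 => u _; rewrite mulr_ge0 ?subordinator_ge0//.
exact: mehler_ge0.
Qed.

Let one_bound k : 0 <= k -> exists (A : R) (N : nat), forall n,
  (\int[lebesgue_measure]_y `|dunkl_coef_integrand k (cst 1) n y|%:E
              <= (A * (n%:R + 2) ^+ N)%:E)%E.
Proof.
move=> k0; have [C [M [C0 growth]]] := dunkl_hermite_growth k0.
exists C, M => n; have [_] := growth n.
congr (_ <= _)%E; apply: eq_integral => y _; congr (_%:E).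
by rewrite /dunkl_coef_integrand /= mul1r [RHS]normrM [X in _ = _ * X]ger0_norm ?powR_ge0.
Qed.

(** Let c_n be the weighted integral of h_n. The mass of the Poisson kernel is
    the series of e^(-t sqrt l_n) c_n h_n(x), hence the average over u of the
    masses of heat kernels, which are known from [integral_mehler_le]. The
    interchange goes through this series in n instead of Tonelli in (u, y), so that
    no joint measurability of the Mehler kernel is required. *)
Lemma integral_poisson_kernel_le k t x : 0 <= k -> 0 < t ->
  (\int[lebesgue_measure]_y (poisson_kernel k t x y * `|y| `^ (2 * k))%:E
   <= (2 `^ (k + 1 / 2) * expR (- (t * Num.sqrt (2 * k + 1))))%:E)%E.
Proof.
move=> k0 t0; have [A [N oneA]] := one_bound k0.
have [C [M [C0 growth]]] := dunkl_hermite_growth k0.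
pose c n : R := dunkl_coef k (cst 1) n.
have m1 : measurable_fun setT (cst 1 : R -> R) by [].
have rP := rapidly_decreasing_poisson k0 t0.
have c_le n : `|c n| <= A * (n%:R + 2) ^+ N.
  exact: norm_dunkl_coef_le (oneA n).
have [iP cP] := cvg_series_poisson_term k0 rP m1 oneA (fun y => cvg_poisson_kernel (x := x) (y := y) k0 t0).
have heat u : 0 < u ->
    series (fun n => ratio t u ^+ n * c n * dunkl_hermite k n x) @ \oo
      --> \int[lebesgue_measure]_y (mehler k (ratio t u) x y * cst 1 y * `|y| `^ (2 * k)).
  move=> u0; have c0 : 0 < t ^+ 2 / (2 * u ^+ 2) by rewrite divr_gt0 ?mulr_gt0 ?exprn_gt0.
  by have [] := cvg_series_poisson_term k0 (rapidly_decreasing_heat c0) m1 oneA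
    (fun y => cvg_mehler (x := x) (y := y) k0 (ratio01 t0 u0)).
pose H u := subordinator t (2 * k + 1) u *
  \int[lebesgue_measure]_y (mehler k (ratio t u) x y * cst 1 y * `|y| `^ (2 * k)).
have cH u : 0 < u ->
    series (fun n => subordinator t (freq k n) u * (c n * dunkl_hermite k n x)) @ \oo --> H u.
  move=> u0.
  have := cvg_seriesZ (c := subordinator t (2 * k + 1) u) (heat u u0).
  rewrite (_ : (fun n => _) = fun n => subordinator t (freq k n) u *
    (c n * dunkl_hermite k n x))//.
  by apply: funext => n; rewrite (subordinator_freq _ _ _ u0) !mulrA.
have cv : cvgn (series (fun n => decay t k n * `|c n * dunkl_hermite k n x|)).
  apply: (cvgn_series_rapid (A := A * C) (M := (N + M)%N) rP) => n.
  rewrite normrM (ger0_norm (rP.1 n)) normr_id ler_wpM2l ?(rP.1 n)// normrM.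
  rewrite (exprD _ N M) mulrACA; apply: ler_pM => //.
  by have [] := growth n.
have [iH sH] := cvg_series_subordinated k0 t0 cv cH.
rewrite [leLHS](_ : _ = (\int[lebesgue_measure]_(u in `]0%R, +oo[) (H u)%:E)%E).
  have [e0 msub] : (0 <= 2 `^ (k + 1 / 2) :> R) /\ measurable_fun (`]0, +oo[%classic : set R)
      (EFin \o subordinator t (2 * k + 1)).
    by split; [exact: powR_ge0|apply/measurable_EFinP; exact: measurable_subordinator].
  have l0 : 0 < 2 * k + 1 by rewrite ltr_wpDl// mulr_ge0.
  rewrite EFinM -(integral_subordinator t0 l0) -ge0_integralZl_EFin//; last first.
    by move=> u _; rewrite lee_fin subordinator_ge0.
  apply: ge0_le_integral => //.
  - move=> u _; rewrite lee_fin mulr_ge0 ?subordinator_ge0//.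
    by apply: Rintegral_ge0 => y _; rewrite /= mulr1 mulr_ge0 ?powR_ge0 ?mehler_ge0.
  - by case/integrableP: iH.
  - by apply/measurable_EFinP; apply: measurable_funM => //; exact/measurable_EFinP.
  - move=> u; rewrite /= in_itv/= andbT => u0.
    rewrite -EFinM lee_fin /H mulrC; apply: ler_wpM2r; first exact: subordinator_ge0.
    have := integral_mehler_le x k0 (ratio01 t0 u0).
    rewrite /Rintegral; under eq_integral do rewrite mulr1.
    by case: (\int[_]_(_ in _) _)%E => [r||].
have PE : (EFin \o fun y : R => poisson_kernel k t x y * cst 1 y * `|y| `^ (2 * k)) =
    fun y : R => (poisson_kernel k t x y * `|y| `^ (2 * k))%:E.
  by apply: funext => y; rewrite /= mulr1.
rewrite -[RHS]fineK; last exact: integrable_fin_num.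
rewrite -[LHS]fineK; last by apply: integrable_fin_num => //; rewrite -PE.
congr (_%:E); rewrite -PE; apply: (cvg_unique _ cP) => //.
rewrite [X in X @ \oo](_ : _ = series (fun n => decay t k n * (c n * dunkl_hermite k n x)))//.
by congr series; apply: funext => n; rewrite mulrA.
Qed.
End poisson_kernel.

(** * Positive symmetric kernels on weighted Lebesgue spaces *)

Section schur.
Context {R : realType}.
Implicit Types (p a C : R).

(** The graph of a^p lies above its tangent at 1; this is Young's inequality
    with second factor 1. *)
Lemma powR_tangent p a : 1 <= p -> 0 <= a -> p * a <= a `^ p + (p - 1).
Proof.
rewrite le_eqVlt => /predU1P[<- a0|p1 a0]; first by rewrite powRr1// mul1r subrr addr0.
have p0 : 0 < p by rewrite (lt_trans ltr01).
have q0 : 0 < p / (p - 1) by rewrite divr_gt0// subr_gt0.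
have p10 : p - 1 != 0 by rewrite gt_eqF// subr_gt0.
(* The conjugate exponent of p is p/(p - 1). *)
have pq : p^-1 + (p / (p - 1))^-1 = 1 by field; rewrite p10 gt_eqF.
have := conjugate_powR a0 ler01 p0 q0 pq.
rewrite powR1 mulr1 => /(ler_wpM2l (ltW p0)).
rewrite [in leRHS]mulrDr [in X in X + _]mulrC divfK ?gt_eqF//.
by rewrite [X in _ + X](_ : _ = p - 1)//; field; rewrite p10 gt_eqF.
Qed.

(** Jensen's inequality for a measure of mass at most C. Integrate the tangent
    inequality for a^p at the point J/C, with J the integral on the left: that is
    the point for which the two terms in J combine with the right power of C. *)
Lemma jensen_powR (K g : R -> R) p C : 1 <= p -> 0 < C ->
  (forall y, 0 <= K y) -> (forall y, 0 <= g y) ->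
  measurable_fun setT K -> measurable_fun setT g ->
  (\int[lebesgue_measure]_y (K y)%:E <= C%:E)%E ->
  (@lebesgue_measure R).-integrable setT (EFin \o (fun y => K y * g y)) ->
  (((\int[lebesgue_measure]_y (K y * g y)) `^ p)%:E <=
   (C `^ (p - 1))%:E * \int[lebesgue_measure]_y (K y * g y `^ p)%:E)%E.
Proof.
move=> p1 C0 K0 g0 mK mg KC iKg.
have p0 : 0 < p by rewrite (lt_le_trans ltr01).
have mgp : measurable_fun setT (fun y => g y `^ p).
  exact: (measurableT_comp (measurable_powR p)).
have JE : (\int[lebesgue_measure]_y (K y * g y)%:E = (\int[lebesgue_measure]_y (K y * g y))%:E)%E.
  by rewrite /Rintegral fineK// integrable_fin_num.
set J := (\int[lebesgue_measure]_y (K y * g y) : R) in JE *.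
set I := (\int[lebesgue_measure]_y (K y * g y `^ p)%:E)%E.
have I0 : (0 <= I)%E by apply: integral_ge0 => y _; rewrite lee_fin mulr_ge0 ?powR_ge0.
have J0 : 0 <= J by apply: Rintegral_ge0 => y _; rewrite mulr_ge0.
have [J_0|Jn0] := eqVneq J 0.
  by rewrite J_0 powR0 ?gt_eqF// mule_ge0// lee_fin powR_ge0.
have {}J0 : 0 < J by rewrite lt_neqAle eq_sym Jn0.
pose l := J / C; have l0 : 0 < l by rewrite divr_gt0.
have pt y : (p / l) * (K y * g y) <= l `^ (- p) * (K y * g y `^ p) + (p - 1) * K y.
  have := powR_tangent p1 (mulr_ge0 (g0 y) (ltW (divr_gt0 ltr01 l0))).
  move=> /(ler_wpM2l (K0 y)); rewrite div1r powRM ?invr_ge0 ?(ltW l0)//.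
  rewrite -powR_inv1 ?(ltW l0)// -powRrM mulN1r => h.
  apply: le_trans (le_trans h _).
    by rewrite powR_inv1 ?(ltW l0)// le_eqVlt; apply/orP; left; apply/eqP; field; rewrite gt_eqF.
  by rewrite le_eqVlt; apply/orP; left; apply/eqP; ring.
have mKg : measurable_fun setT (fun y => K y * g y) by exact: measurable_funM.
have mKgp : measurable_fun setT (fun y => K y * g y `^ p) by exact: measurable_funM.
have h : ((p / l)%:E * J%:E <= (l `^ (- p))%:E * I + (p - 1)%:E * C%:E)%E.
  apply: (@le_trans _ _ ((l `^ (- p))%:E * I + (p - 1)%:E * \int[lebesgue_measure]_y (K y)%:E)%E).
    have e1 : 0 <= p / l by rewrite divr_ge0 ?ltW.
    have e2 : 0 <= p - 1 by rewrite subr_ge0.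
    have e3 : 0 <= l `^ (- p) by exact: powR_ge0.
    have Zl (c : R) (G : R -> R) : 0 <= c -> (forall y, 0 <= G y) -> measurable_fun setT G ->
        (c%:E * \int[lebesgue_measure]_y (G y)%:E = \int[lebesgue_measure]_y (c * G y)%:E)%E.
      move=> c0 G0 mG; rewrite -ge0_integralZl_EFin//; first by move=> y _; rewrite lee_fin.
      exact/measurable_EFinP.
    rewrite -JE /I !Zl// => [|y|y]; [|by rewrite mulr_ge0 ?powR_ge0|by rewrite mulr_ge0].
    rewrite -ge0_integralD//; last 4 first.
    - by move=> y _; rewrite lee_fin !mulr_ge0 ?powR_ge0.
    - by apply/measurable_EFinP; exact: measurable_funM.
    - by move=> y _; rewrite lee_fin mulr_ge0.
    - by apply/measurable_EFinP; exact: measurable_funM.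
    apply: ge0_le_integral => //.
    - by move=> y _; rewrite lee_fin; apply: mulr_ge0 => //; exact: mulr_ge0.
    - by apply/measurable_EFinP; exact: measurable_funM.
    - by apply: emeasurable_funD; apply/measurable_EFinP; exact: measurable_funM.
    - by move=> y _; rewrite -EFinD lee_fin pt.
  by apply: leeD2l; apply: lee_wpmul2l => //; rewrite lee_fin subr_ge0.
move: h I0; case: I => [r||] // h I0; last by rewrite gt0_muley ?leey// lte_fin powR_gt0.
move: h; rewrite -!EFinM -EFinD !lee_fin => h.
have {}h : C <= l `^ (- p) * r.
  rewrite -(lerD2r ((p - 1) * C)); apply: le_trans h.
  rewrite (_ : p / l * J = p * C); first by rewrite mulrBl mul1r addrC subrK.
  by rewrite /l; field; rewrite !gt_eqF.
have JlC : J = l * C by rewrite divfK ?gt_eqF.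
rewrite JlC powRM ?(ltW l0) ?(ltW C0)// -(mulr_powRB1 (ltW C0) p0) mulrA mulrC.
apply: ler_wpM2l; first exact: powR_ge0.
apply: le_trans (ler_wpM2l (powR_ge0 l p) h) _.
by rewrite powRN mulrA divff ?mul1r// gt_eqF// powR_gt0.
Qed.

(** The Schur test, for a symmetric kernel: Jensen in y, then Tonelli and the
    mass bound in x. The two steps contribute C^(p-1) and C. *)
Lemma schur_powR (P : R -> R -> R) (w f : R -> R) p C : 1 <= p -> 0 < C ->
  (forall x y, 0 <= P x y) -> (forall x y, P x y = P y x) ->
  measurable_fun setT (fun z : R * R => P z.1 z.2) ->
  (forall y, 0 <= w y) -> measurable_fun setT w -> measurable_fun setT f ->
  (forall x, (\int[lebesgue_measure]_y (P x y * w y)%:E <= C%:E)%E) ->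
  (forall x, (@lebesgue_measure R).-integrable setT (EFin \o (fun y => P x y * f y * w y))) ->
  measurable_fun setT (fun x : R => \int[lebesgue_measure]_y (P x y * f y * w y)) ->
  (\int[lebesgue_measure]_x (`|\int[lebesgue_measure]_y (P x y * f y * w y)| `^ p * w x)%:E <=
   (C `^ p)%:E * \int[lebesgue_measure]_y (`|f y| `^ p * w y)%:E)%E.
Proof.
move=> p1 C0 P0 Psym mP w0 mw mf PC iPf mF.
have p0 : 0 < p by rewrite (lt_le_trans ltr01).
have C1 : 0 <= C `^ (p - 1) by exact: powR_ge0.
pose v y := `|f y| `^ p * w y.
have v0 y : 0 <= v y by rewrite mulr_ge0 ?powR_ge0.
have mfp : measurable_fun setT (fun y : R => `|f y| `^ p).
  by apply: (measurableT_comp (measurable_powR p)); exact: measurableT_comp.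
have mv : measurable_fun setT v by exact: measurable_funM.
pose H (z : R * R) := (C `^ (p - 1) * (w z.1 * (P z.1 z.2 * v z.2)))%:E.
have mPx x : measurable_fun setT (P x).
  exact: (measurableT_comp (f := fun z : R * R => P z.1 z.2) mP (pair1_measurable x)).
have mH : measurable_fun setT (H : R * R -> \bar R).
  apply/measurable_EFinP; apply: measurable_funM => //; apply: measurable_funM.
    exact: (measurableT_comp mw measurable_fst).
  by apply: measurable_funM => //; exact: (measurableT_comp mv measurable_snd).
have H0 z : (0 <= H z)%E.
  by rewrite lee_fin mulr_ge0// mulr_ge0// mulr_ge0.
apply: (@le_trans _ _ (\int[lebesgue_measure]_x \int[lebesgue_measure]_y H (x, y))%E).
  apply: ge0_le_integral => //.
  - by move=> x _; rewrite lee_fin mulr_ge0// powR_ge0.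
  - apply/measurable_EFinP; apply: measurable_funM => //.
    by apply: (measurableT_comp (measurable_powR p)); exact: measurableT_comp.
  - exact: (measurable_fun_fubini_tonelli_F (m2 := lebesgue_measure) H).
  - move=> x _; pose K y := P x y * w y.
    have K0 y : 0 <= K y by rewrite mulr_ge0.
    have mK : measurable_fun setT K by exact: measurable_funM.
    have nE (y : R) : `|P x y * f y * w y| = K y * `|f y|.
      by rewrite 2!normrM (ger0_norm (P0 x y)) (ger0_norm (w0 y)) mulrAC.
    have iK : (@lebesgue_measure R).-integrable setT (EFin \o (fun y => K y * `|f y|)).
      have := integrable_norm (iPf x); apply: eq_integrable => // y _.
      by rewrite /= nE.
    have := jensen_powR p1 C0 K0 (fun y => normr_ge0 (f y)) mK _ (PC x) iK.
    move=> /(_ (measurableT_comp _ mf)) h.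
    rewrite [leRHS](_ : _ = (w x)%:E *
      ((C `^ (p - 1))%:E * \int[lebesgue_measure]_y (K y * `|f y| `^ p)%:E))%E; last first.
      rewrite muleA -EFinM -ge0_integralZl_EFin//.
      - apply: eq_integral => y _; rewrite -EFinM; congr (_%:E).
        by rewrite /K /v /=; ring.
      - by move=> y _; rewrite lee_fin mulr_ge0 ?powR_ge0.
      - by apply/measurable_EFinP; exact: measurable_funM.
      - exact: mulr_ge0.
    rewrite mulrC EFinM; apply: lee_wpmul2l; first by rewrite lee_fin.
    apply: le_trans (h _) => //.
    rewrite lee_fin; apply: ge0_ler_powR; rewrite ?nnegrE ?(ltW p0)//.
      by apply: Rintegral_ge0 => y _; rewrite mulr_ge0.
    apply: le_trans (le_normr_Rintegral _ (iPf x)) _ => //.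
    by rewrite le_eqVlt; apply/orP; left; apply/eqP; apply: eq_Rintegral => y _.
rewrite (fubini_tonelli (m1 := lebesgue_measure) (m2 := lebesgue_measure) H)//.
apply: (@le_trans _ _ (\int[lebesgue_measure]_y ((C `^ p)%:E * (v y)%:E))%E).
  apply: ge0_le_integral => //.
  - by move=> y _; apply: integral_ge0 => x _.
  - exact: (measurable_fun_fubini_tonelli_G (m1 := lebesgue_measure) H).
  - by apply/measurable_EFinP; exact: measurable_funM.
  - move=> y _.
    rewrite [leLHS](_ : _ = (C `^ (p - 1) * v y)%:E *
      \int[lebesgue_measure]_x (P y x * w x)%:E)%E; last first.
      rewrite -ge0_integralZl_EFin//.
      - apply: eq_integral => x _; rewrite -EFinM; congr (_%:E).
        by rewrite /= (Psym x y); ring.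
      - by move=> x _; rewrite lee_fin mulr_ge0.
      - by apply/measurable_EFinP; exact: (measurable_funM (mPx y) mw).
      - exact: mulr_ge0.
    apply: le_trans (lee_wpmul2l _ (PC y)) _; first by rewrite lee_fin mulr_ge0.
    by rewrite -!EFinM lee_fin mulrAC [_ * C]mulrC mulr_powRB1// ltW.
rewrite ge0_integralZl_EFin//.
- by move=> y _; rewrite lee_fin.
- exact/measurable_EFinP.
- exact: powR_ge0.
Qed.
End schur.

(** * The Poisson integral *)

Section poisson_integral.
Context {R : realType}.
Implicit Types (k p t x y : R) (f : R -> R).

Lemma measurable_poisson_kernel k t : 0 <= k -> 0 < t ->
  measurable_fun setT (fun z : R * R => poisson_kernel k t z.1 z.2).
Proof.
move=> k0 t0.
apply: (measurable_fun_cvg (h := fun N (z : R * R) => series (fun n =>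
  expR (- (t * Num.sqrt (2 * n%:R + 2 * k + 1))) *
  (dunkl_hermite k n z.1 * dunkl_hermite k n z.2)) N)).
- move=> N; apply: measurable_sum => n; apply: measurable_funM => //.
  apply: measurable_funM.
    exact: (measurableT_comp (measurable_dunkl_hermite k n) measurable_fst).
  exact: (measurableT_comp (measurable_dunkl_hermite k n) measurable_snd).
- by move=> z _; exact: cvg_poisson_kernel.
Qed.

(** Since |f| <= 1 + |f|^p, the integral is controlled by the L^1 norm of h_n
    and by its uniform norm times the p-th power of the norm of f. Hence no
    conjugate exponent appears, and p = 1 is not special. *)
Lemma dunkl_coef_integrand_bound k p f : 0 <= k -> 1 <= p -> measurable_fun setT f ->
  (\int[lebesgue_measure]_x (`|f x| `^ p * `|x| `^ (2 * k))%:E < +oo)%E ->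
  exists (A : R) (N : nat), forall n,
  (\int[lebesgue_measure]_y `|dunkl_coef_integrand k f n y|%:E
              <= (A * (n%:R + 2) ^+ N)%:E)%E.
Proof.
move=> k0 p1 mf If; have [C [M [C0 growth]]] := dunkl_hermite_growth k0.
set I := (\int[_]_x _)%E in If.
have I0 : (0 <= I)%E by apply: integral_ge0 => y _; rewrite lee_fin mulr_ge0 ?powR_ge0.
exists (C * (1 + fine I)), M => n; have [hC hI] := growth n.
have b0 : 0 <= C * (n%:R + 2) ^+ M by rewrite mulr_ge0// exprn_ge0// addr_ge0.
have mh : measurable_fun setT (fun y : R => `|dunkl_hermite k n y| * `|y| `^ (2 * k)).
  apply: measurable_funM (measurable_weight k).
  exact: (measurableT_comp (@normr_measurable _ _) (measurable_dunkl_hermite k n)).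
have mfp : measurable_fun setT (fun y : R => `|f y| `^ p * `|y| `^ (2 * k)).
  apply: measurable_funM (measurable_weight k).
  by apply: (measurableT_comp (measurable_powR p)); exact: measurableT_comp.
have -> : C * (1 + fine I) * (n%:R + 2) ^+ M =
    C * (n%:R + 2) ^+ M + C * (n%:R + 2) ^+ M * fine I by ring.
rewrite EFinD (EFinM _ (fine I)) fineK; last by rewrite ge0_fin_numE.
apply: le_trans (leeD hI (lexx _)).
rewrite /I -ge0_integralZl_EFin//; last by exact/measurable_EFinP.
rewrite -ge0_integralD//; last 3 first.
- exact/measurable_EFinP.
- by move=> y _; rewrite -EFinM lee_fin !mulr_ge0 ?powR_ge0 ?exprn_ge0 ?addr_ge0.
- by apply/measurable_EFinP; exact: measurable_funM.
apply: ge0_le_integral => //.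
- apply/measurable_EFinP; apply: measurableT_comp => //.
  exact: measurable_dunkl_coef_integrand.
- by apply: emeasurable_funD; apply/measurable_EFinP => //; exact: measurable_funM.
move=> y _; rewrite -EFinM -EFinD lee_fin.
have fp : `|f y| <= 1 + `|f y| `^ p.
  have [f1|/ltW f1] := leP `|f y| 1; first by rewrite (le_trans f1)// lerDl powR_ge0.
  apply: le_trans (_ : `|f y| `^ p <= _); last by rewrite lerDr.
  by rewrite -[leLHS]powRr1// ler_powR.
rewrite /dunkl_coef_integrand [`|_ * `|y| `^ _|]normrM [`|f y * _|]normrM.
rewrite (ger0_norm (powR_ge0 _ _)).
rewrite [leRHS](_ : _ = (`|dunkl_hermite k n y| + C * (n%:R + 2) ^+ M * `|f y| `^ p) * `|y| `^ (2 * k)); last by ring.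
apply: ler_wpM2r; first exact: powR_ge0.
apply: le_trans (ler_wpM2r (normr_ge0 _) fp) _.
rewrite mulrDl mul1r lerD2l mulrC; apply: ler_wpM2r; [exact: powR_ge0|exact: hC].
Qed.

End poisson_integral.

Theorem theorem2 (R : realType) (k p : R) (f : R -> R)
    (hk : 0 <= k) (hp : 1 <= p) (hf : dunkl_Lp k p f) (t : R) (ht : 0 < t) :
  [/\ (forall n : nat,
         (@lebesgue_measure R).-integrable [set: R]
           (EFin \o dunkl_coef_integrand k f n)),
      (forall x : R, cvgn (series (poisson_term k f t x))),
      dunkl_Lp k p (poisson k f t) &
      (dunkl_norm k p (poisson k f t)
       <= (2 `^ (k + 1 / 2) * expR (- (t * Num.sqrt (2 * k + 1))))%:E
          * dunkl_norm k p f)%E ].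
Proof.
have p0 : 0 < p by rewrite (lt_le_trans ltr01).
have pN0 : p^-1 != 0 by rewrite invr_eq0 gt_eqF.
have [mf nf] := hf.
have If : (\int[lebesgue_measure]_x (`|f x| `^ p * `|x| `^ (2 * k))%:E < +oo)%E.
  rewrite ltey; apply: contraTneq nf => Iy.
  by rewrite /dunkl_norm Iy poweRyr.
have [A [N fA]] := dunkl_coef_integrand_bound hk hp mf If.
have re := rapidly_decreasing_poisson hk ht.
have PI x := cvg_series_poisson_term hk re mf fA (fun y => cvg_poisson_kernel (x := x) (y := y) hk ht).
have cP x : series (poisson_term k f t x) @ \oo -->
    \int[lebesgue_measure]_y (poisson_kernel k t x y * f y * `|y| `^ (2 * k)).
  by have [] := PI x.
have PE : poisson k f t = fun x =>
    \int[lebesgue_measure]_y (poisson_kernel k t x y * f y * `|y| `^ (2 * k)).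
  by apply: funext => x; apply: cvg_lim => //; exact: cP.
have mP : measurable_fun setT (poisson k f t).
  apply: (measurable_fun_cvg (h := fun N x => series (poisson_term k f t x) N)).
  - move=> n; apply: measurable_sum => j.
    by apply: measurable_funM => //; exact: measurable_dunkl_hermite.
  - by move=> x _; rewrite PE.
set C := 2 `^ (k + 1 / 2) * expR (- (t * Num.sqrt (2 * k + 1))).
have C0 : 0 < C by rewrite mulr_gt0 ?powR_gt0 ?expR_gt0.
have bound : (dunkl_norm k p (poisson k f t) <= C%:E * dunkl_norm k p f)%E.
  have h := schur_powR hp C0 (fun x y => poisson_kernel_ge0 x y hk ht)
    (poisson_kernel_sym k t) (measurable_poisson_kernel hk ht)
    (fun y => powR_ge0 _ _) (measurable_weight k) mf
    (fun x => integral_poisson_kernel_le x hk ht) (fun x => (PI x).1).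
  have {}h := h (eq_ind _ (fun g => measurable_fun setT g) mP _ PE).
  have CE : C%:E = poweR (C `^ p)%:E p^-1.
    by rewrite poweR_EFin -powRrM divff ?gt_eqF// powRr1// ltW.
  have J0 (g : R -> R) : (0 <= \int[lebesgue_measure]_x (`|g x| `^ p * `|x| `^ (2 * k))%:E)%E.
    by apply: integral_ge0 => y _; rewrite lee_fin mulr_ge0 ?powR_ge0.
  have Cp0 : (0 <= (C `^ p)%:E)%E by rewrite lee_fin powR_ge0.
  have q0 : 0 <= p^-1 by rewrite invr_ge0 ltW.
  rewrite /dunkl_norm CE -poweRM//; apply: (gt0_ler_poweR q0).
  - by rewrite in_itv/= leey andbT; exact: J0.
  - by rewrite in_itv/= leey andbT; exact: mule_ge0.
  - by rewrite PE; exact: h.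
split.
- by move=> n; exact: integrable_dunkl_coef_integrand (fA n).
- by move=> x; exact: cvgP (cP x).
- split; first exact: mP.
  apply: le_lt_trans bound _.
  by rewrite lte_mul_pinfty// lee_fin ltW.
- exact: bound.
Qed.
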